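(* Let $n,r,d\ge 1$ be integers, let $\mathcal P=\{P_1,\dots,P_k\}$ be a partition of $\{1,\dots,r\}$ into nonempty blocks, and let $c=(c_{i,j})\in\mathbb R^{r\times d}$. Let $\theta=(\theta_1,\dots,\theta_r)$ have a prior distribution on the simplex $\{\theta:\theta_i>0,\ \sum_i\theta_i=1\}$ such that $\theta^{\mathcal P}$ and $\nu$ are independent a priori. Let $\psi=(\psi_1,\dots,\psi_d)$ with $\psi_j=\prod_{i=1}^r\theta_i^{c_{i,j}}$. 1. If $\sum_{i\in P}c_{i,j}=0$ for every $P\in\mathcal P$ and every $1\le j\le d$, then the posterior distribution of $\psi$ given $X$ is the same in the constrained and unconstrained models (that is, for every $x\in\mathbb N^r$ with $\sum_i x_i=n$, the posterior distributions of $\psi$ given $X=x$ in the two models coincide). 2. Suppose that $\sum_{i\in P}c_{i,j}\ne 0$ for some $P\in\mathcal P$ and some $1\le j\le d$, and that the following conditions hold: (i) the prior of $\theta$ has a density $f$ on the simplex with $f(\theta)>0$ for every $\theta$ (full support); (ii) there exists $j^*\in\{1,\dots,d\}$ such that (a) $\sum_{i\in P}c_{i,j^*}\neq 0$ for some $P\in\mathcal P$; (b) for every $x\in\mathbb N^r$ with $\sum_i x_i=n$, the characteristic function $\phi^u_{\rho_{j^*}|X=x}(t)$, $t\in\mathbb R$, of $\rho_{j^*}$ under its posterior distribution given $X=x$ in the unconstrained model is such that $\{t\in\mathbb R:\phi^u_{\rho_{j^*}|X=x}(t)\ne 0\}$ is dense in $\mathbb R$; (c) with $K_+=\{P\in\mathcal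 P:\sum_{i\in P}c_{i,j^*}>0\}$ and $K_-=\{P\in\mathcal P:\sum_{i\in P}c_{i,j^*}<0\}$, either $|K_+|>0$ and $n\ge|K_+|$, or $|K_-|>0$ and $n\ge|K_-|$. Then there exists $x\in\mathbb N^r$ with $\sum_i x_i=n$ such that the posterior distribution of $\psi$ given $X=x$ differs in the constrained and unconstrained models.
   Context: $\mathbb N$ includes $0$. For $P\in\mathcal P$, $\theta^{\mathcal P}_P:=\sum_{i\in P}\theta_i$ and $\theta^{\mathcal P}:=(\theta^{\mathcal P}_P)_{P\in\mathcal P}$; for $i\in P$, $\nu^P_i:=\theta_i/\theta^{\mathcal P}_P$, $\nu^P:=(\nu^P_i)_{i\in P}$, and $\nu:=(\nu^P)_{P\in\mathcal P}$. The map $\theta\leftrightarrow(\theta^{\mathcal P},\nu)$ is one-to-one. Also $\rho_j:=\log\prod_{P\in\mathcal P}\prod_{i\in P}(\nu^P_i)^{c_{i,j}}$. For a vector of counts $x=(x_1,\dots,x_r)$, write $x^{\mathcal P}_P:=\sum_{i\in P}x_i$, $x^{\mathcal P}:=(x^{\mathcal P}_P)_{P\in\mathcal P}$ and $x_P:=(x_i)_{i\in P}$. Unconstrained model: $\theta$ has the given prior, and given $\theta$, $X=(X_1,\dots,X_r)\sim\text{Multinomial}(n,\theta)$. Constrained model: $\theta$ has the same prior, the partition sums $X^{\mathcal P}$ are fixed in advance, and given $\theta$, the vectors $(X_P)_{P\in\mathcal P}$ are independent with $X_P\sim\text{Multinomial}(X^{\mathcal P}_P,\nu^P)$. When the posterior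 given $X=x$ in the constrained model is considered, the fixed partition sums are $X^{\mathcal P}=x^{\mathcal P}$. ''Posterior given $X=x$'' means the conditional distribution given $X=x$ in the model considered.
   Formalization: Part 2 is stated for partitions with at least two blocks (k ≥ 2): for k = 1 one has ν = θ and the constrained and unconstrained models coincide, so the claimed difference of posteriors is always false there. *)

(* Defs.v *)
From HB Require Import structures.
From mathcomp Require Import all_boot all_order all_algebra.
From mathcomp Require Import complex.
From mathcomp Require Import all_classical all_reals all_analysis.

Set Implicit Arguments.
Unset Strict Implicit.
Unset Printing Implicit Defensive.

Import Order.TTheory GRing.Theory Num.Theory.
Import numFieldNormedType.Exports.

Local Open Scope classical_set_scope.
Local Open Scope ring_scope.

(* The partition is a [{set {set 'I_r}}] satisfying finset's [partition];
   parameters are r.-tuple R and count vectors are r.-tuple nat, with the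
   product sigma-algebras. *)

Section Partition.
Variables (R : realType) (r : nat).
Implicit Types (PP : {set {set 'I_r}}) (t : r.-tuple R) (x : r.-tuple nat).

Definition simplex : set (r.-tuple R) :=
  [set t | (forall i, 0 < tnth t i) /\ \sum_(i < r) tnth t i = 1].

Definition block_sum t (B : {set 'I_r}) : R := \sum_(i in B) tnth t i.

Definition block_count x (B : {set 'I_r}) : nat := (\sum_(i in B) tnth x i)%N.

(* theta^PP *)
Definition block_sums PP t : #|PP|.-tuple R :=
  [tuple block_sum t (enum_val k) | k < #|PP|].

(* nu, with all blocks collected in one r-tuple: its i-th entry is nu^P_i for
   the block P = pblock PP i containing i. *)
Definition block_ratios PP t : r.-tuple R :=
  [tuple tnth t i / block_sum t (finset.pblock PP i) | i < r].

Definition psi d (c : 'M[R]_(r, d)) t : d.-tuple R :=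
  [tuple \prod_(i < r) tnth t i `^ c i j | j < d].

Definition rho d (c : 'M[R]_(r, d)) PP (j : 'I_d) t : R :=
  ln (\prod_(B in PP) \prod_(i in B) tnth (block_ratios PP t) i `^ c i j).

(* pmf at (x_i)_{i in B} of the multinomial distribution with m trials and
   cell probabilities (p_i)_{i in B} *)
Definition multinomial_pmf (B : {set 'I_r}) (m : nat) (p : r.-tuple R) x : R :=
  if block_count x B == m then
    (m`!)%:R / (\prod_(i in B) (tnth x i)`!)%N%:R *
    \prod_(i in B) tnth p i ^+ tnth x i
  else 0.

Definition unconstrained_pmf (n : nat) t x : R :=
  multinomial_pmf [set: 'I_r]%SET n t x.

(* s B is the fixed sum of the counts in the block B *)
Definition constrained_pmf PP (s : {set 'I_r} -> nat) t x : R :=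
  \prod_(B in PP) multinomial_pmf B (s B) (block_ratios PP t) x.

End Partition.
Arguments simplex : clear implicits.

(* The parameter is identified with its first r - 1 coordinates; the last one
   is the default value of nth. *)
Definition simplex_chart (R : realType) (r : nat) (u : r.-1.-tuple R) :
    r.-tuple R :=
  [tuple nth (1 - \sum_(j < r.-1) tnth u j) u i | i < r].

Section LebesgueTuple.
Variable R : realType.

(* lebesgue_measure lives on measurableTypeR R, which has the same measurable
   sets as R but another display. *)
Local Notation RL := (measurableTypeR R).

Definition cons_pair m (p : RL * m.-tuple RL) : m.+1.-tuple RL :=
  [the m.+1.-tuple _ of p.1 :: p.2].

Lemma measurable_cons_pair m : measurable_fun setT (@cons_pair m).
Proof. exact: measurable_cons. Qed.

(* \x^ is the variant of the product measure which is a measure as soon as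
   its first factor is sigma-finite. *)
Definition lebesgue_cons m (mu : {measure set m.-tuple RL -> \bar R}) :
    set (m.+1.-tuple RL) -> \bar R :=
  pushforward (@lebesgue_measure R \x^ mu)%E (@cons_pair m).

Section LebesgueConsMeasure.
Variables (m : nat) (mu : {measure set m.-tuple RL -> \bar R}).
Let mcons := @measurable_cons_pair m.

Let lebesgue_cons0 : lebesgue_cons mu set0 = 0%E.
Proof. exact: measure0. Qed.

Let lebesgue_cons_ge0 A : (0 <= lebesgue_cons mu A)%E.
Proof. exact: measure_ge0. Qed.

Let lebesgue_cons_sigma_additive : semi_sigma_additive (lebesgue_cons mu).
Proof. exact: measure_semi_sigma_additive. Qed.

HB.instance Definition _ := isMeasure.Build _ _ _ (lebesgue_cons mu)
  lebesgue_cons0 lebesgue_cons_ge0 lebesgue_cons_sigma_additive.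
End LebesgueConsMeasure.

Fixpoint lebesgue_tuple (m : nat) : {measure set m.-tuple RL -> \bar R} :=
  match m with
  | 0 => dirac [tuple]
  | m'.+1 => lebesgue_cons (lebesgue_tuple m')
  end.

End LebesgueTuple.

(* f is a density of the prior on the simplex, with respect to the Lebesgue
   measure of its first r - 1 coordinates *)
Definition is_simplex_density (R : realType) (r : nat)
    (prior : probability (r.-tuple R) R)
    (f : r.-tuple R -> R) : Prop :=
  [/\ measurable_fun (simplex R r) f,
      forall t, simplex R r t -> 0 <= f t &
      forall A, measurable A -> prior A =
        (\int[lebesgue_tuple R r.-1]_(u in
            @simplex_chart R r @^-1` (A `&` simplex R r))
              (f (simplex_chart u))%:E)%E].

Definition independent_under (d d1 d2 : measure_display)
    (T : measurableType d) (T1 : measurableType d1) (T2 : measurableType d2)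
    (R : realType) (P : probability T R) (f : T -> T1) (g : T -> T2) : Prop :=
  forall A B, measurable A -> measurable B ->
    P (f @^-1` A `&` g @^-1` B) = (P (f @^-1` A) * P (g @^-1` B))%E.

Definition cond_prob (d : measure_display) (T : measurableType d)
    (R : realType) (P : probability T R) (E A : set T) : R :=
  fine (P (A `&` E)) / fine (P E).

Definition cond_expectation (d : measure_display) (T : measurableType d)
    (R : realType) (P : probability T R) (E : set T) (Z : T -> R) : R :=
  (\int[P]_(w in E) Z w) / fine (P E).

Record bayes_model (R : realType) (r : nat) := BayesModel {
  model_disp : measure_display;
  sample_space : measurableType model_disp;
  prob : probability sample_space R;
  param : {RV prob >-> r.-tuple R};
  obs : {RV prob >-> r.-tuple nat} }.

Section Models.
Variables (R : realType) (r : nat).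
Implicit Types (M : bayes_model R r) (x : r.-tuple nat).

(* theta has the given prior, and given theta the observation has pmf
   [lik theta] *)
Definition is_model (prior : probability (r.-tuple R) R)
    (lik : r.-tuple R -> r.-tuple nat -> R) M : Prop :=
  (forall A, measurable A -> distribution (prob M) (param M) A = prior A) /\
  (forall A x, measurable A ->
     prob M (param M @^-1` A `&` obs M @^-1` [set x]) =
     (\int[prior]_(t in A) (lik t x)%:E)%E).

(* Since [obs] is discrete, conditioning on [obs = x] is elementary. *)
Definition posterior (T : Type) M x (g : r.-tuple R -> T) (B : set T) : R :=
  cond_prob (prob M) (obs M @^-1` [set x]) ((g \o param M) @^-1` B).

Definition same_posterior (d : measure_display) (T : measurableType d)
    (g : r.-tuple R -> T) M1 M2 x : Prop :=
  forall B : set T, measurable B -> posterior M1 x g B = posterior M2 x g B.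

Definition posterior_char_fun M x (g : r.-tuple R -> R) (t : R) : R[i] :=
  Complex
    (cond_expectation (prob M) (obs M @^-1` [set x])
       (fun w => cos (t * g (param M w))))
    (cond_expectation (prob M) (obs M @^-1` [set x])
       (fun w => sin (t * g (param M w)))).

End Models.

(* Main.v *)
Require Import Defs.
From mathcomp Require Import all_boot all_order all_algebra.
From mathcomp Require Import complex.
From mathcomp Require Import all_classical all_reals all_analysis.
From mathcomp Require Import measurable_realfun ring lra.

Set Implicit Arguments.
Unset Strict Implicit.
Unset Printing Implicit Defensive.

Import Order.TTheory GRing.Theory Num.Theory.
Import numFieldNormedType.Exports.

Local Open Scope classical_set_scope.
Local Open Scope ring_scope.

(** With eta = theta^PP, the likelihood of x is, up to constants, w(eta) v(nu) in
    the unconstrained model and v(nu) in the constrained one, where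
    w(eta) = \prod_B eta_B ^ x_B. If all block coefficients vanish, psi is a
    function of nu and the factor w integrates out by independence.

    Otherwise log psi_j = S(eta) + rho_j(nu) with S = \sum_B c_B log eta_B. Equality
    of the posteriors says that Z = w / E[w] - 1 satisfies
    E[Z v e^(is (S + rho_j))] = 0 for all s; by independence the characteristic
    function of rho_j splits off, and density and continuity give E[Z e^(isS)] = 0
    for all s. Products of cosines reduce cos((S - a) / m) ^ (m^2) to such terms, and
    letting m tend to infinity, E[Z exp(- (S - a)^2 / 2)] = 0 for every a. If x has a
    positive count in each block with c_B > 0, then w, being at most the smallest of
    the corresponding eta_B, tends to 0 as S tends to -oo, so Z <= -1/2 for S low
    enough; since low values of S have positive probability, a -> -oo gives a
    contradiction. The blocks with c_B < 0 are treated with -S. *)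

(** * Integrals of bounded measurable functions *)

Section BoundedMeasurable.
Context d (T : measurableType d) (R : realType).
Implicit Types (f g : T -> R) (A D : set T).

Definition bounded_mfun f :=
  measurable_fun [set: T] f /\ exists M : R, forall x, `|f x| <= M.

Lemma bounded_mfun_cst (k : R) : bounded_mfun (fun=> k).
Proof. by split; [exact: measurable_cst | exists `|k|]. Qed.

Lemma bounded_mfunN f : bounded_mfun f -> bounded_mfun (fun x => - f x).
Proof.
move=> [mf [M fM]]; split; first exact: measurableT_comp.
by exists M => x; rewrite normrN.
Qed.

Lemma bounded_mfunD f g : bounded_mfun f -> bounded_mfun g ->
  bounded_mfun (fun x => f x + g x).
Proof.
move=> [mf [M fM]] [mg [N gN]]; split; first exact: measurable_funD.
by exists (M + N) => x; rewrite (le_trans (ler_normD _ _))// lerD.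
Qed.

Lemma bounded_mfunB f g : bounded_mfun f -> bounded_mfun g ->
  bounded_mfun (fun x => f x - g x).
Proof. by move=> bf bg; apply: bounded_mfunD => //; exact: bounded_mfunN. Qed.

Lemma bounded_mfunM f g : bounded_mfun f -> bounded_mfun g ->
  bounded_mfun (fun x => f x * g x).
Proof.
move=> [mf [M fM]] [mg [N gN]]; split; first exact: measurable_funM.
by exists (M * N) => x; rewrite normrM ler_pM.
Qed.

Lemma bounded_mfunX f k : bounded_mfun f -> bounded_mfun (fun x => f x ^+ k).
Proof.
move=> bf; elim: k => [|k IH]; first exact: bounded_mfun_cst.
under eq_fun do rewrite exprS.
exact: bounded_mfunM.
Qed.

Lemma bounded_mfun_prod I (s : seq I) (Q : pred I) (F : I -> T -> R) :
  (forall i, bounded_mfun (F i)) ->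
  bounded_mfun (fun x => \prod_(i <- s | Q i) F i x).
Proof.
move=> bF; elim: s => [|i s IH].
  by under eq_fun do rewrite big_nil; exact: bounded_mfun_cst.
under eq_fun do rewrite big_cons.
by case: (Q i) => //; exact: bounded_mfunM.
Qed.

Lemma bounded_mfun_sum I (s : seq I) (Q : pred I) (F : I -> T -> R) :
  (forall i, bounded_mfun (F i)) ->
  bounded_mfun (fun x => \sum_(i <- s | Q i) F i x).
Proof.
move=> bF; elim: s => [|i s IH].
  by under eq_fun do rewrite big_nil; exact: bounded_mfun_cst.
under eq_fun do rewrite big_cons.
by case: (Q i) => //; exact: bounded_mfunD.
Qed.

Lemma bounded_mfun_indic A : measurable A -> bounded_mfun \1_A.
Proof.
move=> mA; split; first exact: measurable_indic.
by exists 1 => x; rewrite indicE; case: (x \in A); rewrite ?normr1// normr0.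
Qed.

Lemma bounded_mfun_cos f : measurable_fun [set: T] f ->
  bounded_mfun (fun x => cos (f x)).
Proof.
move=> mf; split.
  apply: measurableT_comp mf.
  exact: continuous_measurable_fun (@continuous_cos R).
by exists 1 => x; rewrite ler_norml cos_geN1 cos_le1.
Qed.

Lemma bounded_mfun_sin f : measurable_fun [set: T] f ->
  bounded_mfun (fun x => sin (f x)).
Proof.
move=> mf; split.
  apply: measurableT_comp mf.
  exact: continuous_measurable_fun (@continuous_sin R).
by exists 1 => x; rewrite ler_norml sin_geN1 sin_le1.
Qed.

Section Integral.
Variable P : probability T R.

Lemma bounded_mfun_integrable f : bounded_mfun f ->
  P.-integrable [set: T] (EFin \o f).
Proof.
move=> [mf [M fM]]; apply: measurable_bounded_integrable => //.
  by rewrite ltey_eq fin_num_measure.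
exists M; split; first exact: num_real.
by move=> N MN x _; apply: le_trans (fM x) (ltW MN).
Qed.
Local Hint Resolve bounded_mfun_integrable : core.

Lemma EFin_Rintegral f : bounded_mfun f ->
  (\int[P]_x f x)%:E = (\int[P]_x (f x)%:E)%E.
Proof.
by move=> bf; rewrite fineK//; apply: integrable_fin_num => //;
  exact: bounded_mfun_integrable.
Qed.

Lemma bounded_RintegralZ k f : bounded_mfun f ->
  \int[P]_x (k * f x) = k * \int[P]_x f x.
Proof. by move=> bf; rewrite RintegralZl//; exact: bounded_mfun_integrable. Qed.

Lemma bounded_RintegralZr k f : bounded_mfun f ->
  \int[P]_x (f x * k) = \int[P]_x f x * k.
Proof. by move=> bf; rewrite RintegralZr//; exact: bounded_mfun_integrable. Qed.

Lemma bounded_RintegralD f g : bounded_mfun f -> bounded_mfun g ->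
  \int[P]_x (f x + g x) = \int[P]_x f x + \int[P]_x g x.
Proof. by move=> bf bg; rewrite RintegralD//; exact: bounded_mfun_integrable. Qed.

Lemma bounded_RintegralB f g : bounded_mfun f -> bounded_mfun g ->
  \int[P]_x (f x - g x) = \int[P]_x f x - \int[P]_x g x.
Proof. by move=> bf bg; rewrite RintegralB//; exact: bounded_mfun_integrable. Qed.

Lemma bounded_Rintegral_sum I (s : seq I) (F : I -> T -> R) :
  (forall i, bounded_mfun (F i)) ->
  \int[P]_x (\sum_(i <- s) F i x) = \sum_(i <- s) \int[P]_x F i x.
Proof.
move=> bF; elim: s => [|i s IH].
  rewrite big_nil; under eq_Rintegral do rewrite big_nil.
  by rewrite Rintegral_cst// mul0r.
rewrite big_cons -IH -bounded_RintegralD//; last exact: bounded_mfun_sum.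
by under eq_Rintegral do rewrite big_cons.
Qed.

Lemma prob_Rintegral_cst k : \int[P]_x (fun=> k : R) x = k.
Proof. by rewrite Rintegral_cst// [X in fine X](probability_setT P) mulr1. Qed.

Lemma Rintegral_indic_setT A : measurable A -> \int[P]_x \1_A x = fine (P A).
Proof. by move=> mA; rewrite /Rintegral integral_indic// setIT. Qed.

Lemma bounded_Rintegral_mkcond A f :
  \int[P]_(x in A) f x = \int[P]_x (\1_A x * f x).
Proof.
rewrite Rintegral_mkcond; apply: eq_Rintegral => x _.
by rewrite patchE indicE; case: (x \in A); rewrite ?mul1r// mul0r.
Qed.

Section Full.
Variables (D : set T).
Hypotheses (mD : measurable D) (PD : P D = 1%E).

Lemma Rintegral_full f : bounded_mfun f ->
  \int[P]_x f x = \int[P]_x (\1_D x * f x).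
Proof.
move=> bf; rewrite -bounded_Rintegral_mkcond -[in LHS](setvU D).
have PC : P (~` D) = 0%E by rewrite probability_setC// PD subee.
rewrite /Rintegral integral_setU_EFin//; first last.
- by rewrite /disj_set setICl.
- by rewrite setvU; exact: bf.1.
- exact: measurableC.
rewrite [X in (X + _)%E]null_set_integral ?add0e//.
- exact: measurableC.
- by apply/measurable_EFinP; apply: measurable_funS bf.1.
Qed.

Lemma eq_Rintegral_full f g : bounded_mfun f -> bounded_mfun g ->
  (forall x, D x -> f x = g x) -> \int[P]_x f x = \int[P]_x g x.
Proof.
move=> bf bg fg; rewrite (Rintegral_full bf) (Rintegral_full bg).
apply: eq_Rintegral => x _; rewrite indicE.
have [/set_mem xD|_] := boolP (x \in D); last by rewrite !mul0r.
by rewrite fg.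
Qed.

Lemma le_Rintegral_full f g : bounded_mfun f -> bounded_mfun g ->
  (forall x, D x -> f x <= g x) -> \int[P]_x f x <= \int[P]_x g x.
Proof.
move=> bf bg fg; rewrite (Rintegral_full bf) (Rintegral_full bg).
apply: le_Rintegral => //.
- by apply: bounded_mfun_integrable; apply: bounded_mfunM => //;
    exact: bounded_mfun_indic.
- by apply: bounded_mfun_integrable; apply: bounded_mfunM => //;
    exact: bounded_mfun_indic.
move=> x _; rewrite indicE.
have [/set_mem xD|_] := boolP (x \in D); last by rewrite !mul0r.
by rewrite !mul1r fg.
Qed.

Lemma Rintegral_full_gt0 f : bounded_mfun f -> (forall x, D x -> 0 < f x) ->
  0 < \int[P]_x f x.
Proof.
move=> bf f0; rewrite lt_neqAle; apply/andP; split; last first.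
  rewrite -(prob_Rintegral_cst 0); apply: le_Rintegral_full => //.
    exact: bounded_mfun_cst.
  by move=> x Dx; exact: ltW (f0 x Dx).
apply/eqP => I0.
have b1 : bounded_mfun (fun x => \1_D x * f x).
  by apply: bounded_mfunM => //; exact: bounded_mfun_indic.
have m1 : measurable_fun [set: T] (fun x => (\1_D x * f x)%:E).
  by apply/measurable_EFinP; exact: b1.1.
have /(ae_eq_integral_abs P measurableT m1) : (\int[P]_x `|(\1_D x * f x)%:E|)%E = 0%E.
  rewrite -[RHS]/(0%:E) I0 (Rintegral_full bf) EFin_Rintegral//.
  apply: eq_integral => x _; rewrite gee0_abs// lee_fin indicE.
  have [/set_mem xD|_] := boolP (x \in D); last by rewrite mul0r.
  by rewrite mul1r ltW// f0.
move=> [N [mN N0 DN]].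
have : (P D <= P N)%E.
  apply: le_measure; rewrite ?inE// => x Dx; apply: DN => /= /(_ Logic.I) [].
  by move/eqP; rewrite indicE mem_set// mul1r gt_eqF// f0.
by rewrite PD N0 lee_fin ler10.
Qed.

End Full.
End Integral.
End BoundedMeasurable.

Lemma bounded_mfun_comp d (T : measurableType d) d' (T' : measurableType d')
  (R : realType) (h : T' -> T) (f : T -> R) :
  measurable_fun [set: T'] h -> bounded_mfun f -> bounded_mfun (f \o h).
Proof.
move=> mh [mf [M fM]]; split; first exact: measurableT_comp.
by exists M => x; exact: fM.
Qed.

Lemma grid_sum_bounds (R : realType) (y : R) (n : nat) : 0 <= y ->
  Num.min y n%:R <= (\sum_(0 <= k < n) (k%:R < y)%R%:R : R) <= y + 1.
Proof.
move=> y0; suff: Num.min y n%:R <= \sum_(0 <= k < n) (k%:R < y)%R%:R :> R /\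
    \sum_(0 <= k < n) (k%:R < y)%R%:R <= Num.min (y + 1) n%:R :> R.
  by move=> [-> h]; rewrite (le_trans h)// ge_min lexx.
elim: n => [|n [IH1 IH2]].
  by rewrite big_geq// !ge_min le_min lexx orbT addr_ge0.
rewrite big_nat_recr//=.
have [ny|yn] := ltP n%:R y; rewrite /= ?addr0.
  move: IH1 IH2; rewrite (min_idPr (ltW ny)) le_min => IH1 /andP[_ IH2].
  rewrite -natr1; split; first by rewrite ge_min lerD2r IH1 orbT.
  by rewrite le_min !lerD2r IH2 (le_trans IH2 (ltW ny)).
split; first by move: IH1; rewrite (min_idPl yn) ge_min => ->.
rewrite -natr1 (le_trans IH2)//; rewrite le_min ge_min lexx/= ge_min.
by rewrite lerDl ler01 orbT.
Qed.

Section EqOnIndicators.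
Context d (T : measurableType d) d1 (T1 : measurableType d1)
  d2 (T2 : measurableType d2) (R : realType).
Variables (P1 : probability T1 R) (P2 : probability T2 R).
Variables (g1 : T1 -> T) (g2 : T2 -> T) (W1 : T1 -> R) (W2 : T2 -> R).
Hypotheses (mg1 : measurable_fun [set: T1] g1)
  (mg2 : measurable_fun [set: T2] g2)
  (bW1 : bounded_mfun W1) (bW2 : bounded_mfun W2).
Hypothesis eqW : forall A, measurable A ->
  \int[P1]_x (\1_A (g1 x) * W1 x) = \int[P2]_x (\1_A (g2 x) * W2 x).

(* A [0, 1]-valued h is within 1/n of n^-1 \sum_(k < n) \1_(h > k/n). *)
Let grid (h : T -> R) n x : R :=
  n%:R^-1 * \sum_(0 <= k < n) \1_[set y | k%:R < n%:R * h y] x.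

Let measurable_level (h : T -> R) n k : measurable_fun [set: T] h ->
  measurable [set y | k%:R < n%:R * h y :> R].
Proof.
move=> mh; rewrite -[X in measurable X]setTI.
have -> : [set y | k%:R < n%:R * h y :> R] =
    (fun y => n%:R * h y) @^-1` `]k%:R, +oo[%classic.
  by apply/seteqP; split => y /=; rewrite in_itv/= andbT.
by apply: measurable_funM => //; exact: measurable_itv.
Qed.

Let bounded_grid (h : T -> R) n : measurable_fun [set: T] h -> bounded_mfun (grid h n).
Proof.
move=> mh; apply: bounded_mfunM; first exact: bounded_mfun_cst.
by apply: bounded_mfun_sum => k; apply: bounded_mfun_indic; exact: measurable_level.
Qed.

Let grid_approx (h : T -> R) n x : 0 <= h x <= 1 -> `|h x - grid h n.+1 x| <= n.+1%:R^-1.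
Proof.
move=> /andP[h0 h1]; have n0 : 0 < n.+1%:R :> R by rewrite ltr0n.
have := @grid_sum_bounds R (n.+1%:R * h x) n.+1 (mulr_ge0 (ltW n0) h0).
have -> : Num.min (n.+1%:R * h x) n.+1%:R = n.+1%:R * h x.
  by apply/min_idPl; rewrite ler_piMr// ltW.
have -> : \sum_(0 <= k < n.+1) (k%:R < n.+1%:R * h x)%R%:R = n.+1%:R * grid h n.+1 x.
  rewrite /grid mulrA mulfV ?gt_eqF// mul1r; apply: eq_bigr => k _.
  by rewrite indicE; congr (_%:R); congr nat_of_bool; apply/idP/idP; rewrite inE.
move=> /andP[le1 le2]; rewrite ler_pM2l// in le1.
rewrite ler0_norm ?subr_le0// opprB.
rewrite -(ler_pM2l n0) mulfV ?gt_eqF// mulrBr; lra.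
Qed.

Let bound_comp d' (T' : measurableType d') (g : T' -> T) (W : T' -> R) (h : T -> R) :
  measurable_fun [set: T'] g -> bounded_mfun W -> bounded_mfun h ->
  bounded_mfun (fun x => h (g x) * W x).
Proof.
by move=> mg bW bh; apply: bounded_mfunM => //; exact: (bounded_mfun_comp mg bh).
Qed.

Let int_grid d' (T' : measurableType d') (P : probability T' R) (g : T' -> T)
    (W : T' -> R) (h : T -> R) n :
  measurable_fun [set: T'] g -> bounded_mfun W -> measurable_fun [set: T] h ->
  \int[P]_x (grid h n (g x) * W x) =
  n%:R^-1 * \sum_(0 <= k < n)
    \int[P]_x (\1_[set y | k%:R < n%:R * h y :> R] (g x) * W x).
Proof.
move=> mg bW mh.
have bk k : bounded_mfun (fun x => \1_[set y | k%:R < n%:R * h y :> R] (g x) * W x).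
  by apply: bound_comp => //; apply: bounded_mfun_indic; exact: measurable_level.
rewrite -bounded_Rintegral_sum// -bounded_RintegralZ; last exact: bounded_mfun_sum.
by apply: eq_Rintegral => x _; rewrite /grid -mulrA mulr_suml.
Qed.

Let int_near d' (T' : measurableType d') (P : probability T' R) (g : T' -> T)
    (W : T' -> R) (h h' : T -> R) M e :
  measurable_fun [set: T'] g -> bounded_mfun W -> bounded_mfun h -> bounded_mfun h' ->
  (forall x, `|W x| <= M) -> (forall x, `|h x - h' x| <= e) ->
  `|\int[P]_x (h (g x) * W x) - \int[P]_x (h' (g x) * W x)| <= e * M.
Proof.
move=> mg bW bh bh' WM hh'.
have b1 := bound_comp mg bW bh; have b2 := bound_comp mg bW bh'.
rewrite -bounded_RintegralB//.
apply: le_trans (le_normr_Rintegral _ _) _ => //.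
  by apply: bounded_mfun_integrable; exact: bounded_mfunB.
rewrite -[leRHS](prob_Rintegral_cst P); apply: le_Rintegral => //.
- by apply: integrable_norm; apply: bounded_mfun_integrable; exact: bounded_mfunB.
- by apply: bounded_mfun_integrable; exact: bounded_mfun_cst.
by move=> x _ /=; rewrite -mulrBl normrM ler_pM.
Qed.

Let eq01 (h : T -> R) : measurable_fun [set: T] h -> (forall x, 0 <= h x <= 1) ->
  \int[P1]_x (h (g1 x) * W1 x) = \int[P2]_x (h (g2 x) * W2 x).
Proof.
move=> mh h01.
have bh : bounded_mfun h.
  by split => //; exists 1 => x; have /andP[? ?] := h01 x; rewrite ger0_norm.
have [_ [M1 WM1]] := bW1; have [_ [M2 WM2]] := bW2.
apply/eqP; rewrite -subr_eq0 -normr_le0; apply/ler_addgt0Pr => e e0.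
rewrite add0r; set I1 := Rintegral _ _ _; set I2 := Rintegral _ _ _.
have close n : `|I1 - I2| <= n.+1%:R^-1 * (`|M1| + `|M2|).
  pose J1 := \int[P1]_x (grid h n.+1 (g1 x) * W1 x).
  pose J2 := \int[P2]_x (grid h n.+1 (g2 x) * W2 x).
  have J12 : J1 = J2.
    rewrite /J1 /J2 !int_grid//; congr (_ * _).
    by apply: eq_bigr => k _; apply: eqW; exact: measurable_level.
  have -> : I1 - I2 = (I1 - J1) - (I2 - J2) by rewrite J12; ring.
  rewrite (le_trans (ler_normB _ _))// mulrDr lerD//;
    by apply: int_near => // [|x|x]; [exact: bounded_grid |
      exact: le_trans (ler_norm _) | exact: grid_approx].
have [K0|K0] := eqVneq (`|M1| + `|M2|) 0.
  by rewrite (le_trans (close 0))// K0 mulr0 ltW.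
have Kp : 0 < `|M1| + `|M2| by rewrite lt_neqAle eq_sym K0 addr_ge0.
have := archi_boundP (ltW (divr_gt0 Kp e0)); set n := Num.bound _ => ltn.
apply: le_trans (close n) _.
rewrite mulrC ler_pdivrMr ?ltr0n// mulrC -ler_pdivrMr//.
by rewrite (le_trans (ltW ltn))// ler_nat.
Qed.

Lemma eq_Rintegral_of_indic (h : T -> R) : bounded_mfun h ->
  \int[P1]_x (h (g1 x) * W1 x) = \int[P2]_x (h (g2 x) * W2 x).
Proof.
move=> bh; have [mh [M hM]] := bh.
pose K := `|M| + 1; have K0 : 0 < K by rewrite ltr_pwDr.
pose h' x := (2 * K)^-1 * (h x + K).
have bh' : bounded_mfun h'.
  apply: bounded_mfunM; first exact: bounded_mfun_cst.
  by apply: bounded_mfunD => //; exact: bounded_mfun_cst.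
have h'01 x : 0 <= h' x <= 1.
  have : `|h x| <= K by rewrite (le_trans (hM x))// (le_trans (ler_norm _))// lerDl.
  rewrite ler_norml => /andP[hK1 hK2].
  have K20 : 0 < 2 * K by rewrite mulr_gt0.
  apply/andP; split; first by apply: mulr_ge0; [rewrite invr_ge0 ltW | lra].
  by rewrite ler_pdivrMl//; lra.
have split_int d' (T' : measurableType d') (P : probability T' R) (g : T' -> T)
      (W : T' -> R) :
    measurable_fun [set: T'] g -> bounded_mfun W ->
    \int[P]_x (h (g x) * W x) =
    2 * K * \int[P]_x (h' (g x) * W x) - K * \int[P]_x (\1_[set: T] (g x) * W x).
  move=> mg bW.
  have b1 : bounded_mfun (fun x => h' (g x) * W x) by exact: bound_comp.
  have b2 : bounded_mfun (fun x => \1_[set: T] (g x) * W x).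
    by apply: bound_comp => //; exact: bounded_mfun_indic.
  rewrite -!bounded_RintegralZ// -bounded_RintegralB//; last 2 first.
  - by apply: bounded_mfunM => //; exact: bounded_mfun_cst.
  - by apply: bounded_mfunM => //; exact: bounded_mfun_cst.
  apply: eq_Rintegral => x _; rewrite indicT /h' /=.
  by field; rewrite gt_eqF.
by rewrite !split_int// (eq01 bh'.1 h'01) eqW.
Qed.

End EqOnIndicators.

(** * Orthogonality to trigonometric functions *)

Lemma cvg_diff_quotient0 (R : realType) (f : R -> R) (l : R) (u : nat -> R) :
  is_derive (0 : R) (1 : R) f l -> (forall n, u n != 0) ->
  u n @[n --> \oo] --> (0 : R) ->
  ((f (u n) - f 0) / u n) @[n --> \oo] --> l.
Proof.
move=> df un0 u0.
have [dx <-] := df; have := dx.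
move=> /cvgr_dnbhsP /(_ u (conj un0 u0)).
apply: cvg_trans; apply: near_eq_cvg; near=> n.
by rewrite /= addr0 [_ *: _]mulrC -[u n *: 1]/(u n * 1) mulr1.
Unshelve. all: by end_near. Qed.

Lemma normr_exprB_le (R : realType) (a b : R) n : `|a| <= 1 -> `|b| <= 1 ->
  `|a ^+ n - b ^+ n| <= n%:R * `|a - b|.
Proof.
move=> a1 b1; rewrite subrXX normrM mulrC ler_wpM2r//.
rewrite (le_trans (ler_norm_sum _ _ _))//.
rewrite -[leRHS]mulr1 -[n in leRHS]card_ord mulr_natl -sumr_const ler_sum// => i _.
by rewrite normrM !normrX mulr_ile1// exprn_ile1.
Qed.

Lemma cvg_div_succ (R : realType) (y : R) :
  (y / n.+1%:R) @[n --> \oo] --> (0 : R).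
Proof.
rewrite -[X in _ --> X](mulr0 y).
by apply: cvgM; [exact: cvg_cst | exact: cvg_harmonic].
Qed.

(* Both cos z and exp (- z^2 / 2) are 1 - z^2 / 2 + o(z^2). *)
Lemma cvg_cos_pow_gauss (R : realType) (y : R) :
  (cos (y / n.+1%:R) ^+ (n.+1 ^ 2)%N) @[n --> \oo] --> expR (- (y ^+ 2 / 2)).
Proof.
have [->|y0] := eqVneq y 0.
  rewrite expr0n/= mul0r oppr0 expR0.
  by under eq_fun do rewrite mul0r cos0 expr1n; exact: cvg_cst.
pose z n : R := y / n.+1%:R.
have z0 n : z n != 0 by rewrite mulf_neq0// invr_eq0.
have cz : z n @[n --> \oo] --> (0 : R) by exact: cvg_div_succ.
pose w n : R := z n / 2.
have w0 n : w n != 0 by rewrite mulf_neq0// invr_eq0.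
have cw : w n @[n --> \oo] --> (0 : R).
  by rewrite -[X in _ --> X](mul0r 2^-1); apply: cvgM => //; exact: cvg_cst.
pose v n : R := - (z n ^+ 2 / 2).
have v0 n : v n != 0 by rewrite oppr_eq0 mulf_neq0 ?invr_eq0// expf_neq0.
have cv : v n @[n --> \oo] --> (0 : R).
  rewrite -[X in _ --> X]oppr0; apply: cvgN.
  rewrite -[X in _ --> X](mul0r 2^-1); apply: cvgM; last exact: cvg_cst.
  by rewrite -[X in _ --> X](mul0r 0); apply: cvgM.
have c1 : (sin (w n) / w n) @[n --> \oo] --> (1 : R).
  have := cvg_diff_quotient0 (is_derive_sin 0) w0 cw.
  by rewrite cos0; under eq_fun do rewrite sin0 subr0.
have c2 : ((expR (v n) - 1) / v n) @[n --> \oo] --> (1 : R).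
  have := cvg_diff_quotient0 (is_derive_expR 0) v0 cv.
  by rewrite expR0.
pose D n := y ^+ 2 / 2 * ((expR (v n) - 1) / v n - (sin (w n) / w n) ^+ 2).
have cD : D n @[n --> \oo] --> (0 : R).
  rewrite -[X in _ --> X](mulr0 (y ^+ 2 / 2)); apply: cvgM; first exact: cvg_cst.
  rewrite -[X in _ --> X](subrr 1); apply: cvgB => //.
  by rewrite -[X in _ --> X](mulr1 1); apply: cvgM.
have DE n : D n = (n.+1 ^ 2)%:R * (cos (z n) - expR (v n)).
  have -> : cos (z n) = 1 - sin (w n) ^+ 2 *+ 2.
    have -> : z n = w n *+ 2 by rewrite /w -mulr_natr; field.
    by rewrite cos_mulr2n cos2sin2 !mulr2n; ring.
  rewrite /D /v /w natrX.
  have -> : n.+1%:R = y / z n by rewrite /z invf_div mulrCA mulfV// mulr1.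
  by field; rewrite z0.
have eE n : expR (- (y ^+ 2 / 2)) = expR (v n) ^+ (n.+1 ^ 2)%N.
  rewrite -expRM_natl /v natrX /z; congr expR.
  by field; rewrite nat1r pnatr_eq0.
apply/cvgrPdist_le => e e0; move/cvgrPdist_le : cD => /(_ e e0) [N _ hN].
exists N => // n Nn /=; have := hN n Nn; rewrite /= sub0r normrN DE.
apply: le_trans; rewrite (eE n) distrC normrM ger0_norm//.
apply: normr_exprB_le; first by rewrite ler_norml cos_geN1 cos_le1.
rewrite ger0_norm ?expR_ge0// -expR0 ler_expR oppr_le0.
by rewrite divr_ge0// sqr_ge0.
Qed.

Section OrthogonalToTrig.
Context d (T : measurableType d) (R : realType) (P : probability T R).

Lemma bounded_cvg_Rintegral (f_ : nat -> T -> R) (f : T -> R) (M : R) :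
  (forall n, measurable_fun [set: T] (f_ n)) -> measurable_fun [set: T] f ->
  (forall n x, `|f_ n x| <= M) -> (forall x, `|f x| <= M) ->
  (forall x, f_ n x @[n --> \oo] --> f x) ->
  (\int[P]_x f_ n x) @[n --> \oo] --> \int[P]_x f x.
Proof.
move=> mf_ mf fM_ fM cf.
have bf : bounded_mfun f by split => //; exists M.
have bf_ n : bounded_mfun (f_ n) by split => //; exists M.
have [] := @dominated_convergence _ T R P setT measurableT
  (fun n x => (f_ n x)%:E) (fun x => (f x)%:E) (fun=> M%:E).
- by move=> n; apply/measurable_EFinP.
- exact/measurable_EFinP.
- by apply: aeW => x _; apply: cvg_EFin; [exact: nearW | exact: cf].
- exact/bounded_mfun_integrable/bounded_mfun_cst.
- by apply: aeW => x n _; rewrite lee_fin.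
by move=> _ _; rewrite -EFin_Rintegral// => /fine_cvg.
Qed.

Variables (Z S : T -> R).
Hypotheses (bZ : bounded_mfun Z) (mS : measurable_fun [set: T] S).
Hypothesis orth : forall t b, \int[P]_x (Z x * cos (t * S x + b)) = 0.

Let m_affine t b : measurable_fun [set: T] (fun x => t * S x + b).
Proof.
by apply: measurable_funD => //; exact: measurable_funM.
Qed.

Let bcos t b : bounded_mfun (fun x => cos (t * S x + b)).
Proof. exact: bounded_mfun_cos. Qed.

Let orth_cos_pow k u v t b :
  \int[P]_x (Z x * (cos (u * S x + v) ^+ k * cos (t * S x + b))) = 0.
Proof.
elim: k t b => [|k IH] t b.
  by under eq_Rintegral do rewrite expr0 mul1r; exact: orth.
have bk t' b' : bounded_mfun
    (fun x => Z x * (cos (u * S x + v) ^+ k * cos (t' * S x + b'))).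
  by do 2 apply: bounded_mfunM => //; exact: bounded_mfunX.
transitivity (\int[P]_x (2^-1 *
    (Z x * (cos (u * S x + v) ^+ k * cos ((u + t) * S x + (v + b))) +
     Z x * (cos (u * S x + v) ^+ k * cos ((u - t) * S x + (v - b)))))).
  apply: eq_Rintegral => x _; rewrite exprS.
  have -> : (u + t) * S x + (v + b) = (u * S x + v) + (t * S x + b) by ring.
  have -> : (u - t) * S x + (v - b) = (u * S x + v) - (t * S x + b) by ring.
  set p := u * S x + v; set q := t * S x + b.
  by rewrite (cosD p q) (cosB p q); field.
rewrite bounded_RintegralZ; last exact: bounded_mfunD.
by rewrite bounded_RintegralD// !IH addr0 mulr0.
Qed.

Let gauss a x := expR (- ((S x - a) ^+ 2 / 2)).

Let m_gauss a : measurable_fun [set: T] (gauss a).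
Proof.
apply: measurableT_comp; first exact: measurable_expR.
apply: measurable_funN; apply: measurable_funM => //.
by apply: measurable_funX; exact: measurable_funB.
Qed.

Let gauss_le1 a x : `|gauss a x| <= 1.
Proof.
rewrite ger0_norm ?expR_ge0// -expR0 ler_expR oppr_le0.
by rewrite divr_ge0// sqr_ge0.
Qed.

Lemma orth_trig_orth_gauss a : \int[P]_x (Z x * gauss a x) = 0.
Proof.
have [mZ [M ZM]] := bZ.
pose f_ n x := Z x * cos ((S x - a) / n.+1%:R) ^+ (n.+1 ^ 2)%N.
have f_E n : f_ n = (fun x => Z x *
    (cos (n.+1%:R^-1 * S x + (- (a / n.+1%:R))) ^+ (n.+1 ^ 2)%N * cos (0 * S x + 0))).
  apply/funext => x; rewrite mul0r addr0 cos0 mulr1 /f_.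
  by congr (_ * cos _ ^+ _); ring.
have I0 n : \int[P]_x f_ n x = 0 by rewrite f_E; exact: orth_cos_pow.
have cvgI : (\int[P]_x f_ n x) @[n --> \oo] --> \int[P]_x (Z x * gauss a x).
  apply: (@bounded_cvg_Rintegral _ _ M).
  - move=> n; rewrite f_E; apply: (bounded_mfunM bZ (bounded_mfunM _ _)).1 => //.
    exact: bounded_mfunX.
  - exact: measurable_funM.
  - move=> n x; rewrite -[M]mulr1 normrM ler_pM// normrX exprn_ile1//.
    by rewrite ler_norml cos_geN1 cos_le1.
  - by move=> x; rewrite -[M]mulr1 normrM ler_pM.
  - by move=> x; apply: cvgM; [exact: cvg_cst | exact: cvg_cos_pow_gauss].
have : (\int[P]_x f_ n x) @[n --> \oo] --> (0 : R).
  by under eq_fun do rewrite I0; exact: cvg_cst.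
by move/(cvg_unique _ cvgI); apply.
Qed.

(* A Gaussian centred far to the left puts its weight on low values of S,
   where Z is negative. *)
Lemma orth_trig_not_neg (D : set T) (L M : R) : measurable D -> P D = 1%E ->
  (forall x, D x -> S x <= M -> Z x <= - 2^-1) ->
  (0 < P [set x | L <= S x <= M - 1]%R)%E -> False.
Proof.
move=> mD PD Zneg p0; have [mZ [C0 ZC0]] := bZ.
have [C C_gt0 ZC] : exists2 C : R, 0 < C & forall x, Z x <= C.
  exists (`|C0| + 1); first by rewrite ltr_pwDr.
  move=> x; rewrite (le_trans (ler_norm _))// (le_trans (ZC0 x))//.
  by rewrite (le_trans (ler_norm _))// lerDl.
set A := [set x | _] in p0.
have mA : measurable A.
  rewrite -[A]setTI; have -> : A = S @^-1` `[L, M - 1]%classic.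
    by apply/seteqP; split => x /=; rewrite in_itv.
  by apply: mS => //; exact: measurable_itv.
pose p := fine (P A).
have p_gt0 : 0 < p.
  by rewrite -lte_fin fineK ?fin_num_measure.
have [s s1 s2] : exists2 s : R, 2 * C / p + 1 <= s & M - L <= s.
  by exists (Num.max (M - L) (2 * C / p + 1)); rewrite le_max lexx ?orbT.
have s_gt1 : 1 <= s by rewrite (le_trans _ s1)// lerDr divr_ge0 ?ltW// mulr_gt0.
pose a := M - s.
pose E0 := expR (- (s ^+ 2 / 2)); pose E1 := expR (- ((s - 1) ^+ 2 / 2)).
have bg : bounded_mfun (fun x => Z x * gauss a x).
  by apply: bounded_mfunM => //; split => //; exists 1.
have b1 : bounded_mfun (fun x => C * E0 - 2^-1 * E1 * \1_A x).
  apply: bounded_mfunB; first exact: bounded_mfun_cst.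
  by apply: bounded_mfunM; [exact: bounded_mfun_cst | exact: bounded_mfun_indic].
have := @le_Rintegral_full _ T R P D mD PD _ _ bg b1.
rewrite orth_trig_orth_gauss => leI.
have : 0 <= C * E0 - 2^-1 * E1 * p.
  apply: le_trans (leI _) _; last first.
    rewrite bounded_RintegralB; [| exact: bounded_mfun_cst |].
      rewrite prob_Rintegral_cst bounded_RintegralZ; last exact: bounded_mfun_indic.
      by rewrite Rintegral_indic_setT.
    by apply: bounded_mfunM; [exact: bounded_mfun_cst | exact: bounded_mfun_indic].
  move=> x Dx; have g0 := expR_ge0 (- ((S x - a) ^+ 2 / 2)).
  have CE0 : 0 <= C * E0 by rewrite mulr_ge0 ?expR_ge0// ltW.
  have [SM|MS] := leP (S x) M.
    apply: (@le_trans _ _ (- 2^-1 * gauss a x)); first by rewrite ler_wpM2r// Zneg.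
    rewrite indicE; have [/set_mem/= /andP[LS SM1]|_] := boolP (x \in A).
      suff : E1 <= gauss a x by lra.
      rewrite ler_expR lerN2 ler_pM2r ?invr_gt0// ler_pXn2r ?nnegrE ?subr_ge0//.
      - by rewrite /a; lra.
      - by rewrite /a; lra.
    by rewrite mulr0 subr0; rewrite /gauss; lra.
  have -> : \1_A x = 0 :> R.
    rewrite indicE memNset//= => /andP[_ SM1].
    by move: (lt_le_trans MS SM1); rewrite ltrDl oppr_gt0 ltr10.
  rewrite mulr0 subr0; apply: (@le_trans _ _ (C * gauss a x)).
    by rewrite ler_wpM2r.
  rewrite ler_pM2l// ler_expR lerN2 ler_pM2r ?invr_gt0// ler_pXn2r ?nnegrE ?subr_ge0//.
  - by rewrite /a; lra.
  - by rewrite /a; lra.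
  - by rewrite /a; lra.
have -> : E1 = E0 * expR (s - 2^-1).
  by rewrite -expRD; congr expR; field.
have := expR_ge1Dx (s - 2^-1); have E0_gt0 : 0 < E0 by exact: expR_gt0.
move=> le_exp; rewrite subr_ge0 mulrCA [_ * E0]mulrC -!mulrA ler_pM2l// => bad.
have : 2 * C / p < expR (s - 2^-1) by lra.
by rewrite ltr_pdivrMr//; lra.
Qed.

End OrthogonalToTrig.

(** * Independence and posteriors as integrals over the prior *)

Section Independence.
Context d d1 d2 (T : measurableType d) (T1 : measurableType d1)
  (T2 : measurableType d2) (R : realType).

Lemma independent_Rintegral (P : probability T R) (f : T -> T1) (g : T -> T2)
  (h : T1 -> R) (k : T2 -> R) :
  measurable_fun [set: T] f -> measurable_fun [set: T] g ->
  independent_under P f g -> bounded_mfun h -> bounded_mfun k ->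
  \int[P]_x (h (f x) * k (g x)) = \int[P]_x h (f x) * \int[P]_x k (g x).
Proof.
move=> mf mg fg bh bk.
have mfI A : measurable A -> measurable (f @^-1` A).
  by move=> mA; rewrite -[X in measurable X]setTI; exact: mf.
have mgI A : measurable A -> measurable (g @^-1` A).
  by move=> mA; rewrite -[X in measurable X]setTI; exact: mg.
have indic_comp d' (T' : measurableType d') (u : T -> T') A :
    measurable (u @^-1` A) -> \int[P]_x \1_A (u x) = fine (P (u @^-1` A)).
  by move=> mA; rewrite -Rintegral_indic_setT.
have step B : measurable B ->
    \int[P]_x (h (f x) * \1_B (g x)) = \int[P]_x h (f x) * \int[P]_x \1_B (g x).
  move=> mB; rewrite -bounded_RintegralZr; last exact: bounded_mfun_comp.
  apply: (@eq_Rintegral_of_indic _ _ _ _ _ _ R P P f f (\1_B \o g)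
    (fun=> \int[P]_x \1_B (g x))) => //.
  - by apply: bounded_mfun_comp => //; exact: bounded_mfun_indic.
  - exact: bounded_mfun_cst.
  move=> A mA; rewrite bounded_RintegralZr; last first.
    by apply: (bounded_mfun_comp mf); exact: bounded_mfun_indic.
  rewrite !indic_comp; [|exact: mgI|exact: mfI].
  transitivity (\int[P]_x \1_(f @^-1` A `&` g @^-1` B) x).
    by apply: eq_Rintegral => x _; rewrite indicI.
  rewrite Rintegral_indic_setT; last by apply: measurableI; [exact: mfI | exact: mgI].
  by rewrite fg// fineM ?fin_num_measure//; [exact: mfI | exact: mgI].
under eq_Rintegral do rewrite mulrC.
rewrite mulrC -bounded_RintegralZr; last exact: (bounded_mfun_comp mg).
apply: (@eq_Rintegral_of_indic _ _ _ _ _ _ R P P g g (h \o f)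
  (fun=> \int[P]_x h (f x))) => //.
- exact: bounded_mfun_comp.
- exact: bounded_mfun_cst.
move=> B mB; under eq_Rintegral do rewrite mulrC.
rewrite step// mulrC bounded_RintegralZr//.
by apply: (bounded_mfun_comp mg); exact: bounded_mfun_indic.
Qed.

End Independence.

Lemma measurable_tuple_nat r (A : set (r.-tuple nat)) : measurable A.
Proof.
have m1 x : measurable [set x : r.-tuple nat].
  have -> : [set x] = \bigcap_(i : 'I_r) ((@tnth r nat)^~ i @^-1` [set tnth x i]).
    apply/seteqP; split => y /=; first by move=> -> i _.
    by move=> xy; apply: eq_from_tnth => i; exact: xy.
  apply: fin_bigcap_measurable => // i _.
  by rewrite -[X in measurable X]setTI; exact: measurable_tnth.
apply: countable_measurable => //; exact: countableP.
Qed.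

Section Posterior.
Variables (R : realType) (r : nat) (prior : probability (r.-tuple R) R).
Variables (lik : r.-tuple R -> r.-tuple nat -> R) (M : bayes_model R r).
Hypothesis M_model : is_model prior lik M.
Variables (x : r.-tuple nat) (D : set (r.-tuple R)) (L : r.-tuple R -> R).
Hypotheses (mD : measurable D) (priorD : prior D = 1%E)
  (mlik : measurable_fun [set: r.-tuple R] (lik ^~ x)) (bL : bounded_mfun L)
  (likE : forall t, D t -> lik t x = L t).

Let E := obs M @^-1` [set x].

Lemma model_Rintegral h : bounded_mfun h ->
  \int[prob M]_(w in E) h (param M w) = \int[prior]_t (h t * L t).
Proof.
move=> bh.
have mE : measurable E.
  by rewrite -[E]setTI; apply: measurable_funPT => //; exact: measurable_tuple_nat.
rewrite bounded_Rintegral_mkcond; under eq_Rintegral do rewrite mulrC.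
apply: (@eq_Rintegral_of_indic _ _ _ _ _ _ R (prob M) prior (param M) id \1_E L) => //.
  exact: bounded_mfun_indic.
move=> A mA.
have mpA : measurable (param M @^-1` A).
  by rewrite -[X in measurable X]setTI; exact: measurable_funPT.
transitivity (\int[prob M]_w \1_(param M @^-1` A `&` E) w).
  by apply: eq_Rintegral => w _; rewrite indicI.
rewrite Rintegral_indic_setT; last exact: measurableI.
have b1 : bounded_mfun (fun t => \1_A t * L t).
  by apply: bounded_mfunM => //; exact: bounded_mfun_indic.
rewrite M_model.2// -[RHS]bounded_Rintegral_mkcond; congr fine.
apply: ae_eq_integral => //.
- by apply/measurable_EFinP; apply: measurable_funS mlik.
- by apply/measurable_EFinP; apply: measurable_funS bL.1.
exists (~` D); split; first exact: measurableC.
- have : prior (~` D) = 0%E by rewrite probability_setC// priorD subee.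
  exact.
- by move=> t /= tn Dt; apply: tn => At; rewrite likE.
Qed.

Lemma model_prob_obs : fine (prob M E) = \int[prior]_t L t.
Proof.
transitivity (\int[prob M]_(w in E) (fun=> 1 : R) (param M w)).
  rewrite Rintegral_cst ?mul1r//.
  by rewrite -[E]setTI; apply: measurable_funPT => //; exact: measurable_tuple_nat.
rewrite (model_Rintegral (bounded_mfun_cst _ 1)).
by under eq_Rintegral do rewrite mul1r.
Qed.

Lemma cond_expectation_Rintegral h : bounded_mfun h ->
  cond_expectation (prob M) E (fun w => h (param M w)) =
  \int[prior]_t (h t * L t) / \int[prior]_t L t.
Proof. by move=> bh; rewrite /cond_expectation model_Rintegral// model_prob_obs. Qed.

Lemma posterior_Rintegral d (T : measurableType d) (g : r.-tuple R -> T) B :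
  measurable_fun [set: r.-tuple R] g -> measurable B ->
  posterior M x g B =
  \int[prior]_t (\1_B (g t) * L t) / \int[prior]_t L t.
Proof.
move=> mg mB; rewrite /posterior /cond_prob model_prob_obs; congr (_ / _).
have mgB : measurable (g @^-1` B).
  by rewrite -[X in measurable X]setTI; exact: mg.
rewrite -(@model_Rintegral (\1_B \o g)); last first.
  by apply: bounded_mfun_comp => //; exact: bounded_mfun_indic.
rewrite bounded_Rintegral_mkcond.
have mE : measurable E.
  by rewrite -[E]setTI; apply: measurable_funPT => //; exact: measurable_tuple_nat.
have mpA : measurable (param M @^-1` (g @^-1` B)).
  by rewrite -[X in measurable X]setTI; exact: measurable_funPT.
rewrite -Rintegral_indic_setT; last exact: measurableI.
by apply: eq_Rintegral => w _; rewrite indicI mulrC.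
Qed.

End Posterior.

(** * Block sums and block ratios on the simplex *)

Section MeasurableRealFun.
Context d (T : measurableType d) (R : realType).

Lemma measurable_fun_prod_cond I (s : seq I) (Q : pred I) (F : I -> T -> R) :
  (forall i, measurable_fun [set: T] (F i)) ->
  measurable_fun [set: T] (fun x => \prod_(i <- s | Q i) F i x).
Proof.
move=> mF; elim: s => [|i s IH].
  by under eq_fun do rewrite big_nil; exact: measurable_cst.
under eq_fun do rewrite big_cons.
by case: (Q i) => //; exact: measurable_funM.
Qed.

Lemma measurable_fun_sum_cond I (s : seq I) (Q : pred I) (F : I -> T -> R) :
  (forall i, measurable_fun [set: T] (F i)) ->
  measurable_fun [set: T] (fun x => \sum_(i <- s | Q i) F i x).
Proof.
move=> mF; elim: s => [|i s IH].
  by under eq_fun do rewrite big_nil; exact: measurable_cst.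
under eq_fun do rewrite big_cons.
by case: (Q i) => //; exact: measurable_funD.
Qed.

Lemma measurable_fun_powR_cst (f : T -> R) (a : R) :
  measurable_fun [set: T] f -> measurable_fun [set: T] (fun x => f x `^ a).
Proof. exact: (measurableT_comp (measurable_powR a)). Qed.

Lemma measurable_fun_ln (f : T -> R) :
  measurable_fun [set: T] f -> measurable_fun [set: T] (fun x => ln (f x)).
Proof. exact: (measurableT_comp (@measurable_ln R)). Qed.

Lemma measurable_fun_inv (f : T -> R) :
  measurable_fun [set: T] f -> measurable_fun [set: T] (fun x => (f x)^-1).
Proof.
move=> mf.
have -> : (fun x => (f x)^-1) = (fun x => f x * (f x ^+ 2) `^ (-1)).
  apply/funext => x; rewrite powR_inv1 ?sqr_ge0// expr2 invfM.
  by have [->|fx0] := eqVneq (f x) 0; rewrite ?invr0 ?mul0r// mulrA mulfV// mul1r.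
apply: measurable_funM => //; apply: measurable_fun_powR_cst.
exact: measurable_funX.
Qed.

Definition clip01 (y : R) : R := Num.min (Num.max y 0) 1.

Lemma clip01_id y : 0 <= y <= 1 -> clip01 y = y.
Proof. by move=> /andP[y0 y1]; rewrite /clip01 (max_idPl y0) (min_idPl y1). Qed.

Lemma clip01_bounds y : 0 <= clip01 y <= 1.
Proof. by rewrite /clip01 le_min le_max lexx ler01 ge_min lexx !orbT. Qed.

Lemma bounded_mfun_clip01 (f : T -> R) : measurable_fun [set: T] f ->
  bounded_mfun (fun x => clip01 (f x)).
Proof.
move=> mf; split.
  have -> : (fun x => clip01 (f x)) = (f \max cst 0) \min cst 1 by [].
  apply: measurable_minr; last exact: measurable_cst.
  by apply: measurable_maxr => //; exact: measurable_cst.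
exists 1 => x; have /andP[c0 c1] := clip01_bounds (f x).
by rewrite ger0_norm.
Qed.

End MeasurableRealFun.

Section SimplexFunctions.
Variables (R : realType) (r d : nat) (PP : {set {set 'I_r}}).
Implicit Types (x : r.-tuple nat) (t : r.-tuple R) (c : 'M[R]_(r, d)).

Definition count_weight x (e : #|PP|.-tuple R) : R :=
  \prod_(k < #|PP|) clip01 (tnth e k) ^+ block_count x (enum_val k).

Definition ratio_weight x (v : r.-tuple R) : R :=
  \prod_(i < r) clip01 (tnth v i) ^+ tnth x i.

Definition log_sum (a : {set 'I_r} -> R) (e : #|PP|.-tuple R) : R :=
  \sum_(k < #|PP|) a (enum_val k) * ln (tnth e k).

Definition ratio_power c (j : 'I_d) (v : r.-tuple R) : R :=
  \prod_(B in PP) \prod_(i in B) tnth v i `^ c i j.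

Lemma bounded_count_weight x : bounded_mfun (count_weight x).
Proof.
apply: bounded_mfun_prod => k; apply: bounded_mfunX; apply: bounded_mfun_clip01.
exact: measurable_tnth.
Qed.

Lemma bounded_ratio_weight x : bounded_mfun (ratio_weight x).
Proof.
apply: bounded_mfun_prod => k; apply: bounded_mfunX; apply: bounded_mfun_clip01.
exact: measurable_tnth.
Qed.

Lemma measurable_log_sum a : measurable_fun [set: #|PP|.-tuple R] (log_sum a).
Proof.
apply: measurable_fun_sum_cond => k; apply: measurable_funM => //.
by apply: measurable_fun_ln; exact: measurable_tnth.
Qed.

Lemma measurable_ratio_power c j : measurable_fun [set: r.-tuple R] (ratio_power c j).
Proof.
apply: measurable_fun_prod_cond => B; apply: measurable_fun_prod_cond => i.
by apply: measurable_fun_powR_cst; exact: measurable_tnth.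
Qed.

Lemma measurable_psi c : measurable_fun [set: r.-tuple R] (psi c).
Proof.
apply/measurable_fun_tnthP => j.
have -> : (@tnth d R)^~ j \o psi c = (fun t => \prod_(i < r) tnth t i `^ c i j).
  by apply/funext => t; rewrite /= tnth_mktuple.
apply: measurable_fun_prod_cond => i.
by apply: measurable_fun_powR_cst; exact: measurable_tnth.
Qed.

Lemma measurable_block_sum (B : {set 'I_r}) :
  measurable_fun [set: r.-tuple R] (fun t => block_sum t B).
Proof. by apply: measurable_fun_sum_cond => i; exact: measurable_tnth. Qed.

Lemma measurable_block_sums :
  measurable_fun [set: r.-tuple R] (block_sums PP : _ -> #|PP|.-tuple R).
Proof.
apply/measurable_fun_tnthP => k.
have -> : (@tnth #|PP| R)^~ k \o block_sums PP = (fun t => block_sum t (enum_val k)).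
  by apply/funext => t; rewrite /= tnth_mktuple.
exact: measurable_block_sum.
Qed.

Lemma measurable_block_ratios :
  measurable_fun [set: r.-tuple R] (block_ratios PP : _ -> r.-tuple R).
Proof.
apply/measurable_fun_tnthP => i.
have -> : (@tnth r R)^~ i \o block_ratios PP =
    (fun t => tnth t i * (block_sum t (finset.pblock PP i))^-1).
  by apply/funext => t; rewrite /= tnth_mktuple.
apply: measurable_funM; first exact: measurable_tnth.
by apply: measurable_fun_inv; exact: measurable_block_sum.
Qed.

Lemma measurable_multinomial_pmf (B : {set 'I_r}) m x :
  measurable_fun [set: r.-tuple R] (fun p => multinomial_pmf B m p x).
Proof.
rewrite /multinomial_pmf; case: (_ == m); last exact: measurable_cst.
apply: measurable_funM; first exact: measurable_cst.
apply: measurable_fun_prod_cond => i; apply: measurable_funX.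
exact: measurable_tnth.
Qed.

Lemma measurable_constrained_pmf s x :
  measurable_fun [set: r.-tuple R] (fun t => constrained_pmf PP s t x).
Proof.
apply: measurable_fun_prod_cond => B.
apply: (measurableT_comp (measurable_multinomial_pmf B (s B) x)).
exact: measurable_block_ratios.
Qed.

Lemma measurable_simplex : measurable (simplex R r).
Proof.
have -> : simplex R r =
    (\bigcap_(i : 'I_r) ((@tnth r R)^~ i @^-1` `]0, +oo[%classic)) `&`
    ((fun t => \sum_(i < r) tnth t i) @^-1` [set 1]).
  apply/seteqP; split => t /=.
    by move=> [t0 t1]; split=> // i _; rewrite /= in_itv/= andbT.
  by move=> [t0 t1]; split=> // i; have := t0 i Logic.I; rewrite /= in_itv/= andbT.
apply: measurableI.
  apply: fin_bigcap_measurable => // i _.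
  by rewrite -[X in measurable X]setTI; apply: measurable_tnth.
rewrite -[X in measurable X]setTI; apply: measurable_fun_sum_cond => // i.
exact: measurable_tnth.
Qed.

Hypothesis partPP : finset.partition PP [set: 'I_r]%SET.

Let prodE (F : 'I_r -> R) : \prod_(i < r) F i = \prod_(B in PP) \prod_(i in B) F i.
Proof. by rewrite -(set_partition_big _ partPP); apply: eq_bigl => i; rewrite inE. Qed.

Lemma partition_block_neq0 B : B \in PP -> exists i, i \in B.
Proof.
move=> PB; apply/set0Pn; apply: contraTneq PB => ->.
by have /and3P[] := partPP.
Qed.

Section OnSimplex.
Variable t : r.-tuple R.
Hypothesis st : simplex R r t.

Lemma block_sum_gt0 B : B \in PP -> 0 < block_sum t B.
Proof.
move=> /partition_block_neq0[i iB]; rewrite /block_sum (bigD1 i)//= ltr_pwDl ?st.1//.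
by apply: sumr_ge0 => j _; exact: ltW (st.1 j).
Qed.

Lemma block_sum_le1 B : block_sum t B <= 1.
Proof.
rewrite -st.2 /block_sum [leRHS](bigID [in B])/= lerDl.
by apply: sumr_ge0 => j _; exact: ltW (st.1 j).
Qed.

Lemma block_ratioE B i : B \in PP -> i \in B ->
  tnth (block_ratios PP t) i = tnth t i / block_sum t B.
Proof.
move=> PB iB; rewrite tnth_mktuple (def_pblock _ PB iB)//.
by have /and3P[] := partPP.
Qed.

Lemma block_ratio_gt0 i : 0 < tnth (block_ratios PP t) i.
Proof.
have : i \in finset.cover PP by have /and3P[/eqP -> _ _] := partPP; rewrite inE.
move/bigcupP => [B PB iB]; rewrite (block_ratioE PB iB).
by rewrite divr_gt0 ?st.1// block_sum_gt0.
Qed.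

Lemma block_ratio_le1 i : tnth (block_ratios PP t) i <= 1.
Proof.
have : i \in finset.cover PP by have /and3P[/eqP -> _ _] := partPP; rewrite inE.
move/bigcupP => [B PB iB]; rewrite (block_ratioE PB iB).
rewrite ler_pdivrMr ?block_sum_gt0// mul1r /block_sum (bigD1 i)//= lerDl.
by apply: sumr_ge0 => j _; exact: ltW (st.1 j).
Qed.

Lemma coord_block_ratio B i : B \in PP -> i \in B ->
  tnth t i = block_sum t B * tnth (block_ratios PP t) i.
Proof.
move=> PB iB; rewrite (block_ratioE PB iB) mulrC divfK//.
by rewrite gt_eqF// block_sum_gt0.
Qed.

Lemma count_weightE x :
  count_weight x (block_sums PP t) = \prod_(B in PP) block_sum t B ^+ block_count x B.
Proof.
rewrite [RHS]big_enum_val; apply: eq_bigr => k _.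
rewrite tnth_mktuple clip01_id// block_sum_le1 ltW// block_sum_gt0//.
exact: enum_valP.
Qed.

Lemma count_weight_gt0 x : 0 < count_weight x (block_sums PP t).
Proof.
rewrite count_weightE; apply: prodr_gt0 => B PB.
by rewrite exprn_gt0// block_sum_gt0.
Qed.

Lemma ratio_weightE x :
  ratio_weight x (block_ratios PP t) =
  \prod_(i < r) tnth (block_ratios PP t) i ^+ tnth x i.
Proof.
apply: eq_bigr => i _; rewrite clip01_id// block_ratio_le1 ltW//.
exact: block_ratio_gt0.
Qed.

Lemma ratio_weight_gt0 x : 0 < ratio_weight x (block_ratios PP t).
Proof.
rewrite ratio_weightE; apply: prodr_gt0 => i _.
by rewrite exprn_gt0// block_ratio_gt0.
Qed.

Lemma log_sumE a : log_sum a (block_sums PP t) =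
  \sum_(B in PP) a B * ln (block_sum t B).
Proof.
by rewrite [RHS]big_enum_val; apply: eq_bigr => k _; rewrite tnth_mktuple.
Qed.

Lemma ratio_power_gt0 c j : 0 < ratio_power c j (block_ratios PP t).
Proof.
apply: prodr_gt0 => B _; apply: prodr_gt0 => i _.
by rewrite powR_gt0// block_ratio_gt0.
Qed.

Lemma psiE c j : tnth (psi c t) j =
  expR (log_sum (fun B => \sum_(i in B) c i j) (block_sums PP t)) *
  ratio_power c j (block_ratios PP t).
Proof.
rewrite log_sumE tnth_mktuple prodE expR_sum -big_split/=.
apply: eq_bigr => B PB; rewrite mulr_suml expR_sum -big_split/=.
apply: eq_bigr => i iB; rewrite (coord_block_ratio PB iB) powRM ?ltW//.
- by rewrite /powR gt_eqF// block_sum_gt0.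
- exact: block_sum_gt0.
- exact: block_ratio_gt0.
Qed.

Lemma ln_psi c j : ln (tnth (psi c t) j) =
  log_sum (fun B => \sum_(i in B) c i j) (block_sums PP t) + rho c PP j t.
Proof.
by rewrite psiE lnM ?posrE ?expR_gt0 ?ratio_power_gt0// expRK.
Qed.

Lemma unconstrained_pmfE n x : (\sum_(i < r) tnth x i)%N = n ->
  unconstrained_pmf n t x = (n`!)%:R / (\prod_(i < r) (tnth x i)`!)%N%:R *
    (count_weight x (block_sums PP t) * ratio_weight x (block_ratios PP t)).
Proof.
move=> xn; rewrite /unconstrained_pmf /multinomial_pmf.
have -> : block_count x [set: 'I_r]%SET = n.
  by rewrite -xn; apply: eq_bigl => i; rewrite inE.
rewrite eqxx; congr (_ / _%:R * _); first by apply: eq_bigl => i; rewrite inE.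
rewrite count_weightE ratio_weightE prodE -big_split/=.
rewrite (eq_bigl predT); last by move=> i; rewrite inE.
rewrite prodE; apply: eq_bigr => B PB.
rewrite /block_count -prodrXr -big_split/=; apply: eq_bigr => i iB.
by rewrite (coord_block_ratio PB iB) exprMn.
Qed.

Lemma constrained_pmfE x : constrained_pmf PP (block_count x) t x =
  (\prod_(B in PP) ((block_count x B)`!%:R / (\prod_(i in B) (tnth x i)`!)%N%:R)) *
  ratio_weight x (block_ratios PP t).
Proof.
rewrite ratio_weightE prodE -big_split/=; apply: eq_bigr => B PB.
by rewrite /multinomial_pmf eqxx.
Qed.

End OnSimplex.
End SimplexFunctions.

(** * Positive densities on the simplex *)

Section DensityPositive.
Variable R : realType.
Local Notation RL := (measurableTypeR R).

Definition cube (m : nat) (a : nat -> R) (e : R) : set (m.-tuple RL) :=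
  [set u | forall i : 'I_m, a i - e <= tnth u i <= a i + e].

Lemma measurable_cube m a e : measurable (@cube m a e).
Proof.
have -> : @cube m a e = \bigcap_(i : 'I_m)
    ((fun u : m.-tuple RL => tnth u i) @^-1` `[a i - e, a i + e]%classic).
  by apply/seteqP; split => u /= => [uE i _|uE i]; [rewrite /= in_itv/= uE|
    have := uE i Logic.I; rewrite /= in_itv/=].
apply: fin_bigcap_measurable => // i _.
rewrite -[X in measurable X]setTI; exact: (@measurable_tnth _ RL).
Qed.

Lemma lebesgue_cube_gt0 m a e : 0 < e ->
  (0 < lebesgue_tuple R m (@cube m a e))%E.
Proof.
move=> e0; elim: m a => [|m IH] a /=.
  rewrite diracE mem_set ?lte01//.
  by move=> [].
rewrite /lebesgue_cons /pushforward.
have -> : @cons_pair R m @^-1` @cube m.+1 a e =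
    `[a 0%N - e, a 0%N + e]%classic `*` @cube m (a \o S) e.
  apply/seteqP; split => -[y u] /=; rewrite ?in_itv/=.
    move=> H; split; first by have := H ord0.
    by move=> i; have := H (lift ord0 i); rewrite tnthS.
  move=> [y0 uH] i; have [->|[j ->]] : i = ord0 \/ exists j, i = lift ord0 j.
  - by case: (unliftP ord0 i) => [j ->|->]; [right; exists j | left].
  - exact: y0.
  - by rewrite tnthS; exact: uH.
rewrite product_measure2E; [|exact: measurable_itv|exact: measurable_cube].
rewrite mule_gt0//.
rewrite [X in (_ < X)%E]lebesgue_measure_itv/= lte_fin.
have -> : a 0%N - e < a 0%N + e by lra.
by rewrite -EFinB lte_fin; lra.
Qed.

Lemma measurable_simplex_chart r : measurable_fun [set: r.-1.-tuple RL]
  (@simplex_chart R r : r.-1.-tuple RL -> r.-tuple R).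
Proof.
apply/measurable_fun_tnthP => i.
have -> : (@tnth r R)^~ i \o @simplex_chart R r =
    (fun u : r.-1.-tuple RL => nth (1 - \sum_(j < r.-1) tnth u j) u i).
  by apply/funext => u; rewrite /= tnth_mktuple.
have [ir|ri] := ltnP i r.-1.
  have -> : (fun u : r.-1.-tuple RL => nth (1 - \sum_(j < r.-1) tnth u j) u i) =
      (fun u : r.-1.-tuple RL => tnth u (Ordinal ir)).
    by apply/funext => u; rewrite (tnth_nth (1 - \sum_(j < r.-1) tnth u j)).
  exact: (@measurable_tnth _ RL).
have -> : (fun u : r.-1.-tuple RL => nth (1 - \sum_(j < r.-1) tnth u j) u i) =
    (fun u : r.-1.-tuple RL => 1 - \sum_(j < r.-1) tnth u j).
  by apply/funext => u; rewrite nth_default// size_tuple.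
apply: measurable_funB => //; apply: measurable_fun_sum_cond => j.
exact: (@measurable_tnth _ RL).
Qed.

Lemma simplex_chart_near m (t0 : m.+1.-tuple R) : simplex R m.+1 t0 ->
  exists2 e : R, 0 < e & forall u : m.-tuple RL, @cube m (nth 0 t0) e u ->
    let t := @simplex_chart R m.+1 u in
    simplex R m.+1 t /\ forall i, `|tnth t i - tnth t0 i| <= tnth t0 i / 2.
Proof.
move=> [t0_gt0 t0_sum].
pose p := \prod_(i < m.+1) tnth t0 i; pose e := p / (2 * m.+1%:R).
have p_gt0 : 0 < p by apply: prodr_gt0 => i _; exact: t0_gt0.
have t0_le1 i : tnth t0 i <= 1.
  rewrite -t0_sum (bigD1 i)//= lerDl; apply: sumr_ge0 => j _; exact: ltW (t0_gt0 j).
have p_le i : p <= tnth t0 i.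
  rewrite /p (bigD1 i)//= ler_piMr//; first exact: ltW (t0_gt0 i).
  by apply: prodr_ile1 => j; rewrite t0_le1 ltW.
have e_gt0 : 0 < e by rewrite divr_gt0// mulr_gt0// ltr0n.
have me1 : m.+1%:R * e = p / 2 by rewrite /e; field; rewrite nat1r pnatr_eq0.
have me : m%:R * e <= p / 2 by rewrite -me1 ler_wpM2r ?ler_nat// ltW.
have e_le : e <= p / 2 by rewrite -me1 ler_peMl ?ler1n// ltW.
exists e => // u uE /=; set t := @simplex_chart R m.+1 u.
have uE' (k : 'I_m) : `|tnth u k - nth 0 t0 k| <= e.
  by have := uE k; rewrite ler_distl.
have tE (k : 'I_m) : tnth t (widen_ord (leqnSn m) k) = tnth u k.
  by rewrite tnth_mktuple/= -tnth_nth.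
have tmax : tnth t ord_max = 1 - \sum_(k < m) tnth u k.
  by rewrite tnth_mktuple/= nth_default// size_tuple.
have t_near i : `|tnth t i - tnth t0 i| <= tnth t0 i / 2.
  apply: (@le_trans _ _ (p / 2)); last by rewrite ler_pM2r ?invr_gt0.
  case: (unliftP ord_max i) => [k ->|->].
    have -> : lift ord_max k = widen_ord (leqnSn m) k.
      by apply: val_inj; rewrite /= /bump leqNgt ltn_ord.
    by rewrite tE (tnth_nth 0 t0)/= (le_trans (uE' k)).
  have -> : tnth t ord_max - tnth t0 ord_max =
      \sum_(k < m) (tnth t0 (widen_ord (leqnSn m) k) - tnth u k).
    by rewrite tmax sumrB; move: t0_sum; rewrite big_ord_recr/=; lra.
  rewrite (le_trans (ler_norm_sum _ _ _))//.
  apply: le_trans me.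
  rewrite -[m in leRHS]card_ord mulr_natl -sumr_const ler_sum// => k _.
  by rewrite distrC (tnth_nth 0 t0).
split=> //; split=> [i|].
  have := t_near i; rewrite ler_distl => /andP[+ _].
  by apply: lt_le_trans; have := t0_gt0 i; lra.
rewrite big_ord_recr/= tmax; under eq_bigr do rewrite tE.
by rewrite addrC subrK.
Qed.

Lemma simplex_density_gt0 r (prior : probability (r.-tuple R) R) f
    (A : set (r.-tuple R)) (t0 : r.-tuple R) :
  is_simplex_density prior f -> (forall t, simplex R r t -> 0 < f t) ->
  simplex R r t0 -> measurable A ->
  (forall t, simplex R r t ->
     (forall i, `|tnth t i - tnth t0 i| <= tnth t0 i / 2) -> A t) ->
  (0 < prior A)%E.
Proof.
move=> [mf _ priorE] f_gt0; case: r => [|m] in prior f A t0 mf priorE f_gt0 *.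
  by move=> [_]; rewrite big_ord0 => /eqP; rewrite eq_sym oner_eq0.
move=> st0 mA nearA.
have [e e_gt0 cubeE] := simplex_chart_near st0.
rewrite lt_neqAle measure_ge0 andbT; apply/eqP => /esym; rewrite priorE//.
set U := (X in (\int[_]_(_ in X) _)%E).
have mU : measurable (U : set (m.-tuple RL)).
  rewrite -[U]setTI; apply: (@measurable_simplex_chart m.+1) => //.
  by apply: measurableI => //; exact: measurable_simplex.
have mfU : measurable_fun (U : set (m.-tuple RL))
    (fun u => (f (@simplex_chart R m.+1 u))%:E).
  apply/measurable_EFinP.
  apply: (measurable_comp (F := simplex R m.+1) (g := @simplex_chart R m.+1)) mf _.
  - exact: measurable_simplex.
  - by move=> _ [u [_ su] <-].
  - exact: measurable_funS (@measurable_simplex_chart m.+1).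
move=> int0.
have : (\int[lebesgue_tuple R m]_(u in U) `|(f (@simplex_chart R m.+1 u))%:E| = 0)%E.
  rewrite -[RHS]int0; apply: eq_integral => u /set_mem[_ su].
  by rewrite gee0_abs// lee_fin ltW// f_gt0.
move/(ae_eq_integral_abs _ mU mfU) => [N [mN N0 UN]].
have := @lebesgue_cube_gt0 m (nth 0 t0) e e_gt0.
rewrite lt_neqAle => /andP[/eqP + _]; apply; apply/esym.
apply: (subset_measure0 _ mN _ N0); first exact: measurable_cube.
move=> u uC; apply: UN => /= H; have [su near0] := cubeE u uC.
have /H [] : U u by split=> //; exact: nearA.
by move/eqP; rewrite gt_eqF// f_gt0.
Qed.

End DensityPositive.

Section LowLogSum.
Variables (R : realType) (r : nat) (PP : {set {set 'I_r}}).
Hypothesis partPP : finset.partition PP [set: 'I_r]%SET.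
Variables (a : {set 'I_r} -> R) (B0 : {set 'I_r}).
Hypotheses (PB0 : B0 \in PP) (aB0 : 0 < a B0) (PP_gt1 : (1 < #|PP|)%N).

Let notin_B0 B i : B \in PP -> B != B0 -> i \in B -> i \notin B0.
Proof.
move=> PB BB0 iB; have /and3P[_ tiP _] := partPP.
have := finset.trivIsetP tiP B B0 PB PB0 BB0.
by move/disjointFr => /(_ i iB) ->.
Qed.

(* Giving each index of B0 the weight e and the others the weight 1 makes
   theta_B0 of order e while the other block sums stay above 1 / r. *)
Lemma simplex_low_log_sum (N : R) :
  exists2 t, simplex R r t & log_sum a (block_sums PP t) <= N.
Proof.
have [i0 i0B0] : exists i, i \notin B0.
  have /set0Pn[B] : PP :\ B0 != finset.set0.
    by rewrite -card_gt0; move: PP_gt1; rewrite (cardsD1 B0) PB0.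
  rewrite !inE => /andP[BB0 PB]; have [i iB] := partition_block_neq0 partPP PB.
  by exists i; exact: notin_B0 BB0 iB.
have r_gt0 : (0 < r)%N by apply: leq_ltn_trans (ltn_ord i0).
have rR : 0 < r%:R :> R by rewrite ltr0n.
have r_ge1 : 1 <= r%:R :> R by rewrite ler1n.
pose C := \sum_(B in PP) `|a B| * ln r%:R.
have C_ge0 : 0 <= C.
  by apply: sumr_ge0 => B _; rewrite mulr_ge0// ln_ge0.
pose K := (C + `|N|) / a B0.
have K_ge0 : 0 <= K by rewrite divr_ge0 ?addr_ge0// ltW.
pose e := expR (- K) / r%:R.
have e_gt0 : 0 < e by rewrite divr_gt0// expR_gt0.
have e_le1 : e <= 1.
  rewrite ler_pdivrMr// mul1r (le_trans _ r_ge1)// -expR0 ler_expR.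
  by rewrite oppr_le0.
pose s (i : 'I_r) := if i \in B0 then e else 1.
have s_gt0 i : 0 < s i by rewrite /s; case: ifP.
have s_le1 i : s i <= 1 by rewrite /s; case: ifP.
pose W := \sum_(i < r) s i.
have W_ge1 : 1 <= W.
  rewrite /W (bigD1 i0)//= {1}/s (negbTE i0B0) lerDl.
  by apply: sumr_ge0 => i _; exact: ltW.
have W_gt0 : 0 < W by rewrite (lt_le_trans ltr01).
have W_le : W <= r%:R.
  by rewrite -[r in leRHS]card_ord -sumr_const ler_sum.
pose t := [tuple s i / W | i < r].
have st : simplex R r t.
  split=> [i|]; first by rewrite tnth_mktuple divr_gt0.
  under eq_bigr do rewrite tnth_mktuple.
  by rewrite -mulr_suml mulfV// gt_eqF.
have tE i : tnth t i = s i / W by rewrite tnth_mktuple.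
exists t => //.
have low : ln (block_sum t B0) <= - K.
  rewrite -[leRHS]expRK ler_ln ?posrE ?expR_gt0 ?(block_sum_gt0 partPP st)//.
  have -> : block_sum t B0 = \sum_(i in B0) e / W.
    by apply: eq_bigr => i iB0; rewrite tE /s iB0.
  rewrite sumr_const -mulr_natl.
  apply: (@le_trans _ _ (r%:R * e)); last by rewrite /e mulrC divfK// gt_eqF.
  apply: ler_pM => //; first by rewrite divr_ge0// ltW.
    by rewrite ler_nat -[leqRHS]card_ord max_card.
  by rewrite ler_pdivrMr// ler_peMr// ltW.
have high B : B \in PP -> B != B0 -> `|ln (block_sum t B)| <= ln r%:R.
  move=> PB BB0; have bgt0 := block_sum_gt0 partPP st PB.
  rewrite ler0_norm; last by rewrite ln_le0// block_sum_le1.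
  rewrite -lnV// ler_ln ?posrE ?invr_gt0// -[leRHS]invrK lef_pV2 ?posrE ?invr_gt0//.
  have [i iB] := partition_block_neq0 partPP PB.
  apply: (@le_trans _ _ (tnth t i)).
    by rewrite tE /s (negbTE (notin_B0 PB BB0 iB)) div1r lef_pV2 ?posrE.
  rewrite /block_sum (bigD1 i)//= lerDl; apply: sumr_ge0 => j _.
  exact: ltW (st.1 j).
rewrite log_sumE (bigD1 B0)//=.
have : \sum_(B in PP | B != B0) a B * ln (block_sum t B) <= C.
  rewrite /C [leRHS](bigD1 B0)//= -[leLHS]add0r lerD//.
    by rewrite mulr_ge0// ln_ge0.
  apply: ler_sum => B /andP[PB BB0]; rewrite (le_trans (ler_norm _))//.
  by rewrite normrM ler_wpM2l// high.
have : a B0 * ln (block_sum t B0) <= - (C + `|N|).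
  apply: (@le_trans _ _ (a B0 * - K)); first by rewrite ler_pM2l.
  by rewrite /K mulrN mulrC divfK// gt_eqF.
have : - `|N| <= N by rewrite lerNl ler_normr lexx orbT.
lra.
Qed.

Lemma log_sum_near (t t0 : r.-tuple R) : simplex R r t0 -> simplex R r t ->
  (forall i, `|tnth t i - tnth t0 i| <= tnth t0 i / 2) ->
  `|log_sum a (block_sums PP t) - log_sum a (block_sums PP t0)| <=
  \sum_(B in PP) `|a B| * ln 2.
Proof.
move=> st0 st near0; rewrite !log_sumE -sumrB.
rewrite (le_trans (ler_norm_sum _ _ _))// ler_sum// => B PB.
rewrite -mulrBr normrM ler_wpM2l//.
have b0 := block_sum_gt0 partPP st0 PB; have b1 := block_sum_gt0 partPP st PB.
have : `|block_sum t B - block_sum t0 B| <= block_sum t0 B / 2.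
  rewrite /block_sum -sumrB (le_trans (ler_norm_sum _ _ _))// mulr_suml.
  by apply: ler_sum => i _; exact: near0.
rewrite ler_distl => /andP[lo hi].
rewrite ler_distl; apply/andP; split.
  rewrite lerBlDr -lnM ?posrE// ler_ln ?posrE ?mulr_gt0//; lra.
rewrite -lnM ?posrE// ler_ln ?posrE ?mulr_gt0//; lra.
Qed.

Lemma prior_log_sum_low (prior : probability (r.-tuple R) R) f (M : R) :
  is_simplex_density prior f -> (forall t, simplex R r t -> 0 < f t) ->
  exists L : R,
    (0 < prior [set t | L <= log_sum a (block_sums PP t) <= M]%R)%E.
Proof.
move=> priorf f_gt0; pose C := \sum_(B in PP) `|a B| * ln 2.
have [t0 st0 low] := simplex_low_log_sum (M - C).
exists (log_sum a (block_sums PP t0) - C).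
apply: (simplex_density_gt0 priorf f_gt0 st0).
  set S := (fun t => log_sum a (block_sums PP t)).
  have -> : [set t | log_sum a (block_sums PP t0) - C <= S t <= M] =
      S @^-1` `[log_sum a (block_sums PP t0) - C, M]%classic.
    by apply/seteqP; split => t /=; rewrite in_itv.
  rewrite -[X in measurable X]setTI.
  have : measurable_fun [set: r.-tuple R] S.
    apply: measurableT_comp; first exact: measurable_log_sum.
    exact: measurable_block_sums.
  by apply => //; exact: measurable_itv.
move=> t st /(log_sum_near st0 st); rewrite ler_distl => /andP[h1 h2] /=.
by rewrite h1 (le_trans h2)//; move: low; rewrite /C; lra.
Qed.

End LowLogSum.

(** * Weights of the block sums *)

Lemma counts_positive_on_blocks r n (PP K : {set {set 'I_r}}) :
  finset.partition PP [set: 'I_r]%SET -> K \subset PP ->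
  (0 < #|K|)%N -> (#|K| <= n)%N ->
  exists2 x : r.-tuple nat, (\sum_(i < r) tnth x i)%N = n &
    forall B, B \in K -> (0 < block_count x B)%N.
Proof.
move=> partPP KPP K_gt0 Kn.
have [B1 KB1] : exists B1, B1 \in K by apply/card_gt0P.
have [i1 _] := partition_block_neq0 partPP (fintype.subsetP KPP _ KB1).
pose rep (B : {set 'I_r}) := odflt i1 [pick i in B].
have repP B : B \in K -> rep B \in B.
  move=> KB; rewrite /rep; case: pickP => // B0.
  have [i iB] := partition_block_neq0 partPP (fintype.subsetP KPP _ KB).
  by have := B0 i; rewrite iB.
pose y (i : 'I_r) := (\sum_(B in K) (rep B == i) + (i == i1) * (n - #|K|))%N.
exists [tuple y i | i < r].
  under eq_bigr do rewrite tnth_mktuple.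
  rewrite big_split/= exchange_big/=.
  rewrite [X in (X + _)%N](_ : _ = #|K|); last first.
    rewrite -sum1_card; apply: eq_bigr => B KB.
    by rewrite (bigD1 (rep B))//= eqxx big1// => i; rewrite eq_sym => /negbTE ->.
  rewrite (bigD1 i1)//= eqxx mul1n big1 ?addn0 ?subnKC// => i /negbTE ->.
  by rewrite mul0n.
move=> B KB; rewrite /block_count (bigD1 (rep B)) ?repP//= tnth_mktuple.
by rewrite /y (bigD1 B)//= eqxx.
Qed.

Section CountWeight.
Variables (R : realType) (r : nat) (PP : {set {set 'I_r}}).
Hypothesis partPP : finset.partition PP [set: 'I_r]%SET.
Variables (prior : probability (r.-tuple R) R) (x : r.-tuple nat).
Hypothesis prior_simplex : prior (simplex R r) = 1%E.

Let w (t : r.-tuple R) := count_weight (PP := PP) x (block_sums PP t).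
Let Ew := \int[prior]_t w t.

Lemma bounded_count_weight_block_sums : bounded_mfun w.
Proof.
apply: bounded_mfun_comp; first exact: measurable_block_sums.
exact: bounded_count_weight.
Qed.

Lemma count_weight_integral_gt0 : 0 < Ew.
Proof.
apply: (Rintegral_full_gt0 (@measurable_simplex R r) prior_simplex).
  exact: bounded_count_weight_block_sums.
by move=> t st; exact: count_weight_gt0.
Qed.

Lemma count_weight_le_block t B : simplex R r t -> B \in PP ->
  (0 < block_count x B)%N -> w t <= block_sum t B.
Proof.
move=> st PB xB; rewrite /w count_weightE// (bigD1 B)//=.
have bs C : C \in PP -> 0 <= block_sum t C <= 1.
  by move=> PC; rewrite block_sum_le1// ltW// (block_sum_gt0 partPP).
have /andP[b0 b1] := bs B PB.
rewrite -[leRHS]mulr1 ler_pM//.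
- exact: exprn_ge0.
- apply: prodr_ge0 => C /andP[PC _]; apply: exprn_ge0; by have /andP[] := bs C PC.
- by rewrite -(prednK xB) exprS ler_piMr// exprn_ile1.
- apply: prodr_ile1 => C /andP[PC _]; have /andP[c0 c1] := bs C PC.
  by rewrite exprn_ge0//= exprn_ile1.
Qed.

Lemma count_weight_not_orth_trig (a : {set 'I_r} -> R) (f : r.-tuple R -> R) :
  (1 < #|PP|)%N -> (exists2 B, B \in PP & 0 < a B) ->
  (forall B, B \in PP -> 0 < a B -> (0 < block_count x B)%N) ->
  is_simplex_density prior f -> (forall t, simplex R r t -> 0 < f t) ->
  ~ (forall s b, \int[prior]_t
      ((w t / Ew - 1) * cos (s * log_sum a (block_sums PP t) + b)) = 0).
Proof.
move=> PP_gt1 [B0 PB0 aB0] xpos priorf f_gt0 orth.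
have Ew_gt0 := count_weight_integral_gt0.
have mSx : measurable (simplex R r) by exact: measurable_simplex.
have bw := bounded_count_weight_block_sums.
have Ew_le1 : Ew <= 1.
  rewrite -(prob_Rintegral_cst prior 1).
  apply: (le_Rintegral_full mSx prior_simplex) => //.
    exact: bounded_mfun_cst.
  move=> t st; rewrite (le_trans (count_weight_le_block st PB0 _)) ?xpos//.
  exact: block_sum_le1.
pose q := Ew / 2; have q_gt0 : 0 < q by rewrite divr_gt0.
have lnq : ln q <= 0 by rewrite ln_le0// /q; lra.
pose M := \sum_(B in PP) `|a B| * ln q - 1.
have [L PL] := prior_log_sum_low partPP PB0 aB0 PP_gt1 (M - 1) priorf f_gt0.
have bZ : bounded_mfun (fun t => w t / Ew - 1).
  apply: bounded_mfunB; last exact: bounded_mfun_cst.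
  by apply: bounded_mfunM => //; exact: bounded_mfun_cst.
have mS : measurable_fun [set: r.-tuple R] (fun t => log_sum a (block_sums PP t)).
  apply: measurableT_comp; first exact: measurable_log_sum.
  exact: measurable_block_sums.
apply: (orth_trig_not_neg bZ mS orth mSx prior_simplex _ PL) => t st SM.
have [B PB /andP[aB bq]] : exists2 B, B \in PP & (0 < a B) && (block_sum t B <= q).
  apply/exists_inP; apply: contraLR SM => /exists_inPn noB.
  rewrite -ltNge log_sumE /M ltrBlDr ltr_pwDr//.
  apply: ler_sum => B PB; have b0 := block_sum_gt0 partPP st PB.
  have [aB|aB] := ltP 0 (a B).
    rewrite gtr0_norm// ler_pM2l// ler_ln ?posrE//.
    by have := noB B PB; rewrite aB/= -ltNge => /ltW.
  apply: (@le_trans _ _ 0); first by rewrite mulr_ge0_le0.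
  by rewrite mulr_le0// ln_le0// block_sum_le1.
have : w t / Ew <= 2^-1.
  rewrite ler_pdivrMr// mulrC (le_trans (count_weight_le_block st PB _))//.
  exact: xpos.
lra.
Qed.

End CountWeight.

(** * Comparison of the posteriors *)

Section Posteriors.
Variables (R : realType) (n r d : nat) (PP : {set {set 'I_r}}).
Hypothesis partPP : finset.partition PP [set: 'I_r]%SET.
Variables (c : 'M[R]_(r, d)) (prior : probability (r.-tuple R) R).
Hypothesis prior_simplex : prior (simplex R r) = 1%E.
Hypothesis indep : independent_under prior (block_sums PP) (block_ratios PP).
Variables (Mu Mc : bayes_model R r) (x : r.-tuple nat).
Hypothesis Mu_model : is_model prior (unconstrained_pmf n) Mu.
Hypothesis Mc_model : is_model prior (constrained_pmf PP (block_count x)) Mc.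
Hypothesis xn : (\sum_(i < r) tnth x i)%N = n.

Let w (t : r.-tuple R) := count_weight (PP := PP) x (block_sums PP t).
Let v (t : r.-tuple R) := ratio_weight x (block_ratios PP t).
Let Ew := \int[prior]_t w t.
Let Ev := \int[prior]_t v t.

Let mD := @measurable_simplex R r.

Let bw : bounded_mfun w.
Proof. exact: bounded_count_weight_block_sums. Qed.

Let bv : bounded_mfun v.
Proof.
apply: bounded_mfun_comp; first exact: measurable_block_ratios.
exact: bounded_ratio_weight.
Qed.

Let bwv : bounded_mfun (fun t => w t * v t).
Proof. exact: bounded_mfunM. Qed.

Let Ew_gt0 : 0 < Ew.
Proof. exact: count_weight_integral_gt0. Qed.

Let Ev_gt0 : 0 < Ev.
Proof.
by apply: (Rintegral_full_gt0 mD prior_simplex) => // t st; exact: ratio_weight_gt0.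
Qed.

Lemma indep_block_Rintegral (h : #|PP|.-tuple R -> R) (k : r.-tuple R -> R) :
  bounded_mfun h -> bounded_mfun k ->
  \int[prior]_t (h (block_sums PP t) * k (block_ratios PP t)) =
  \int[prior]_t h (block_sums PP t) * \int[prior]_t k (block_ratios PP t).
Proof.
move=> bh bk; apply: independent_Rintegral => //.
  exact: measurable_block_sums.
exact: measurable_block_ratios.
Qed.

Let multinomial_const : R := (n`!)%:R / (\prod_(i < r) (tnth x i)`!)%N%:R.

Let multinomial_const_neq0 : multinomial_const != 0.
Proof.
rewrite mulf_neq0 ?invr_eq0 ?pnatr_eq0 -?lt0n ?fact_gt0//.
by rewrite prodn_gt0// => i; rewrite fact_gt0.
Qed.

Let Ewv : \int[prior]_t (w t * v t) = Ew * Ev.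
Proof.
apply: indep_block_Rintegral; first exact: bounded_count_weight.
exact: bounded_ratio_weight.
Qed.

Let scaled_ratio (K : R) (u h : r.-tuple R -> R) : K != 0 ->
  bounded_mfun u -> bounded_mfun h ->
  \int[prior]_t (h t * (K * u t)) / \int[prior]_t (K * u t) =
  \int[prior]_t (h t * u t) / \int[prior]_t u t.
Proof.
move=> K0 bu bh; under eq_Rintegral do rewrite mulrCA.
rewrite !bounded_RintegralZ//; last exact: bounded_mfunM.
by rewrite invfM mulrACA mulfV// mul1r.
Qed.

Let bKwv : bounded_mfun (fun t => multinomial_const * (w t * v t)).
Proof. by apply: bounded_mfunM => //; exact: bounded_mfun_cst. Qed.

Lemma unconstrained_cond_expectation (h : r.-tuple R -> R) : bounded_mfun h ->
  cond_expectation (prob Mu) (obs Mu @^-1` [set x]) (fun y => h (param Mu y)) =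
  \int[prior]_t (h t * (w t * v t)) / (Ew * Ev).
Proof.
move=> bh; rewrite (cond_expectation_Rintegral Mu_model mD prior_simplex _ bKwv)//.
- by rewrite scaled_ratio// Ewv.
- exact: measurable_multinomial_pmf.
- by move=> t st; exact: unconstrained_pmfE.
Qed.

Lemma unconstrained_posterior d' (T : measurableType d') (g : r.-tuple R -> T) B :
  measurable_fun [set: r.-tuple R] g -> measurable B ->
  posterior Mu x g B = \int[prior]_t (\1_B (g t) * (w t * v t)) / (Ew * Ev).
Proof.
move=> mg mB; rewrite (posterior_Rintegral Mu_model mD prior_simplex _ bKwv)//.
- rewrite (scaled_ratio (h := \1_B \o g))// ?Ewv//.
  by apply: bounded_mfun_comp => //; exact: bounded_mfun_indic.
- exact: measurable_multinomial_pmf.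
- by move=> t st; exact: unconstrained_pmfE.
Qed.

Lemma constrained_posterior d' (T : measurableType d') (g : r.-tuple R -> T) B :
  measurable_fun [set: r.-tuple R] g -> measurable B ->
  posterior Mc x g B = \int[prior]_t (\1_B (g t) * v t) / Ev.
Proof.
move=> mg mB.
pose K : R :=
  \prod_(B in PP) ((block_count x B)`!%:R / (\prod_(i in B) (tnth x i)`!)%N%:R).
have K0 : K != 0.
  apply/prodf_neq0 => C _; rewrite mulf_neq0 ?invr_eq0 ?pnatr_eq0 -?lt0n ?fact_gt0//.
  by rewrite prodn_cond_gt0// => i _; rewrite fact_gt0.
have bKv : bounded_mfun (fun t => K * v t).
  by apply: bounded_mfunM => //; exact: bounded_mfun_cst.
rewrite (posterior_Rintegral Mc_model mD prior_simplex _ bKv)//.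
- rewrite (scaled_ratio (h := \1_B \o g))//.
  by apply: bounded_mfun_comp => //; exact: bounded_mfun_indic.
- exact: measurable_constrained_pmf.
- by move=> t st; exact: constrained_pmfE.
Qed.

Lemma same_posterior_of_block_coef0 :
  (forall B j, B \in PP -> \sum_(i in B) c i j = 0) ->
  same_posterior (psi c) Mu Mc x.
Proof.
move=> c0 B mB; have mpsi := measurable_psi c.
rewrite unconstrained_posterior// constrained_posterior//.
pose Psi (u : r.-tuple R) := [tuple ratio_power PP c j u | j < d].
have mPsi : measurable_fun [set: r.-tuple R] Psi.
  apply/measurable_fun_tnthP => j.
  have -> : (@tnth d R)^~ j \o Psi = ratio_power PP c j.
    by apply/funext => u; rewrite /= tnth_mktuple.
  exact: measurable_ratio_power.
have psiE0 t : simplex R r t -> psi c t = Psi (block_ratios PP t).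
  move=> st; apply: eq_from_tnth => j; rewrite (psiE partPP st) tnth_mktuple.
  rewrite log_sumE big1 ?expR0 ?mul1r// => C PC.
  by rewrite c0// mul0r.
have bB : bounded_mfun (\1_B \o psi c : _ -> R).
  by apply: bounded_mfun_comp => //; exact: bounded_mfun_indic.
have bk : bounded_mfun (fun u => \1_B (Psi u) * ratio_weight x u : R).
  apply: bounded_mfunM; last exact: bounded_ratio_weight.
  by apply: (bounded_mfun_comp mPsi); exact: bounded_mfun_indic.
have bk' : bounded_mfun (fun t => \1_B (Psi (block_ratios PP t)) * v t : R).
  by apply: (bounded_mfun_comp _ bk); exact: measurable_block_ratios.
have -> : \int[prior]_t (\1_B (psi c t) * (w t * v t)) =
    Ew * \int[prior]_t (\1_B (Psi (block_ratios PP t)) * v t).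
  rewrite -(indep_block_Rintegral (bounded_count_weight R PP x) bk).
  apply: (eq_Rintegral_full mD prior_simplex).
  - exact: bounded_mfunM.
  - exact: bounded_mfunM.
  - by move=> t st; rewrite psiE0// mulrCA.
rewrite -mulf_div mulfV ?gt_eqF// mul1r; congr (_ / _).
apply: (eq_Rintegral_full mD prior_simplex) => //; first exact: bounded_mfunM.
by move=> t st; rewrite psiE0.
Qed.

Section OrthogonalLogSum.
Variable j : 'I_d.

Let S (e : #|PP|.-tuple R) := log_sum (fun B => \sum_(i in B) c i j) e.
Let Z (e : #|PP|.-tuple R) := count_weight x e / Ew - 1.
Let lr (u : r.-tuple R) := ln (ratio_power PP c j u).

Let bZ : bounded_mfun Z.
Proof.
apply: bounded_mfunB; last exact: bounded_mfun_cst.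
apply: bounded_mfunM; last exact: bounded_mfun_cst.
exact: bounded_count_weight.
Qed.

Let mS s b : measurable_fun [set: #|PP|.-tuple R] (fun e => s * S e + b).
Proof.
apply: measurable_funD; last exact: measurable_cst.
apply: measurable_funM; first exact: measurable_cst.
exact: measurable_log_sum.
Qed.

Let mlr s : measurable_fun [set: r.-tuple R] (fun u => s * lr u).
Proof.
apply: measurable_funM; first exact: measurable_cst.
by apply: measurable_fun_ln; exact: measurable_ratio_power.
Qed.

Let block_comp (h : #|PP|.-tuple R -> R) : bounded_mfun h ->
  bounded_mfun (fun t => h (block_sums PP t)).
Proof. by move=> bh; apply: (bounded_mfun_comp _ bh); exact: measurable_block_sums. Qed.

Let ratio_comp (k : r.-tuple R -> R) : bounded_mfun k ->
  bounded_mfun (fun t => k (block_ratios PP t)).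
Proof. by move=> bk; apply: (bounded_mfun_comp _ bk); exact: measurable_block_ratios. Qed.

Let bZcos s b : bounded_mfun (fun e => Z e * cos (s * S e + b)).
Proof. by apply: bounded_mfunM => //; exact: bounded_mfun_cos. Qed.

Let bZsin s b : bounded_mfun (fun e => Z e * sin (s * S e + b)).
Proof. by apply: bounded_mfunM => //; exact: bounded_mfun_sin. Qed.

Let bvcos s : bounded_mfun (fun u => ratio_weight x u * cos (s * lr u)).
Proof.
by apply: bounded_mfunM; [exact: bounded_ratio_weight | exact: bounded_mfun_cos].
Qed.

Let bvsin s : bounded_mfun (fun u => ratio_weight x u * sin (s * lr u)).
Proof.
by apply: bounded_mfunM; [exact: bounded_ratio_weight | exact: bounded_mfun_sin].
Qed.

Let X s b := \int[prior]_t (Z (block_sums PP t) * cos (s * S (block_sums PP t) + b)).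
Let Y s b := \int[prior]_t (Z (block_sums PP t) * sin (s * S (block_sums PP t) + b)).
Let Cv s := \int[prior]_t (v t * cos (s * lr (block_ratios PP t))).
Let Sv s := \int[prior]_t (v t * sin (s * lr (block_ratios PP t))).

Hypothesis same : same_posterior (psi c) Mu Mc x.

Let same_Rintegral (h : d.-tuple R -> R) : bounded_mfun h ->
  \int[prior]_t (h (psi c t) * (Z (block_sums PP t) * v t)) = 0.
Proof.
move=> bh; have mpsi := measurable_psi c.
have bwv' : bounded_mfun (fun t => Ew^-1 * (w t * v t)).
  by apply: bounded_mfunM => //; exact: bounded_mfun_cst.
have bhpsi : bounded_mfun (fun t => h (psi c t)) by exact: bounded_mfun_comp.
have eqI : \int[prior]_t (h (psi c t) * (Ew^-1 * (w t * v t))) =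
    \int[prior]_t (h (psi c t) * v t).
  apply: eq_Rintegral_of_indic => // A mA.
  have bA : bounded_mfun (fun t => \1_A (psi c t) : R).
    by apply: (bounded_mfun_comp mpsi); exact: bounded_mfun_indic.
  under eq_Rintegral do rewrite mulrCA.
  rewrite bounded_RintegralZ; last exact: bounded_mfunM.
  have := same mA; rewrite unconstrained_posterior// constrained_posterior//.
  move=> /(congr1 (fun y => y * Ev)); rewrite divfK ?gt_eqF// => <-.
  by field; rewrite !gt_eqF.
transitivity (\int[prior]_t (h (psi c t) * (Ew^-1 * (w t * v t)) - h (psi c t) * v t)).
  by apply: eq_Rintegral => t _; rewrite /Z -/(w t); ring.
by rewrite bounded_RintegralB ?eqI ?subrr//; exact: bounded_mfunM.
Qed.

Let char_eq s b : X s b * Cv s - Y s b * Sv s = 0.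
Proof.
rewrite -(indep_block_Rintegral (bZcos s b) (bvcos s)).
rewrite -(indep_block_Rintegral (bZsin s b) (bvsin s)).
rewrite -bounded_RintegralB; first last.
- by apply: bounded_mfunM; [exact: block_comp (bZsin s b) | exact: ratio_comp (bvsin s)].
- by apply: bounded_mfunM; [exact: block_comp (bZcos s b) | exact: ratio_comp (bvcos s)].
pose h (y : d.-tuple R) : R := cos (s * ln (tnth y j) + b).
have bh : bounded_mfun h.
  apply: bounded_mfun_cos; apply: measurable_funD; last exact: measurable_cst.
  apply: measurable_funM; first exact: measurable_cst.
  by apply: measurable_fun_ln; exact: measurable_tnth.
rewrite -(same_Rintegral bh).
apply: (eq_Rintegral_full mD prior_simplex).
- apply: bounded_mfunB; apply: bounded_mfunM.
  + exact: block_comp (bZcos s b).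
  + exact: ratio_comp (bvcos s).
  + exact: block_comp (bZsin s b).
  + exact: ratio_comp (bvsin s).
- apply: bounded_mfunM; first by apply: (bounded_mfun_comp _ bh); exact: measurable_psi.
  by apply: bounded_mfunM => //; exact: block_comp bZ.
move=> t st; rewrite /h (ln_psi partPP st).
have -> : s * (log_sum (fun B => \sum_(i in B) c i j) (block_sums PP t) +
      rho c PP j t) + b =
    (s * S (block_sums PP t) + b) + s * lr (block_ratios PP t).
  by rewrite /S /lr -/(rho c PP j t); ring.
set p := s * S _ + b; set q := s * lr _.
by rewrite (cosD p q) /Z /v /w /=; ring.
Qed.

Let X_eq0 s b : posterior_char_fun Mu x (rho c PP j) s != 0 -> X s b = 0.
Proof.
move=> phi_neq0.
have Xshift : X s (b - pi / 2) = Y s b.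
  apply: eq_Rintegral => t _; rewrite addrA cosB cos_pihalf sin_pihalf.
  by congr (_ * _); ring.
have Yshift : Y s (b - pi / 2) = - X s b.
  rewrite -[RHS]mulN1r /X -bounded_RintegralZ; last exact: block_comp (bZcos s b).
  by apply: eq_Rintegral => t _; rewrite addrA sinB cos_pihalf sin_pihalf; ring.
have e1 := char_eq s b; have := char_eq s (b - pi / 2).
rewrite Xshift Yshift => e2.
have e3 : X s b * (Cv s ^+ 2 + Sv s ^+ 2) = 0.
  transitivity ((X s b * Cv s - Y s b * Sv s) * Cv s +
    (Y s b * Cv s - - X s b * Sv s) * Sv s); first by ring.
  by rewrite e1 e2 !mul0r addr0.
have /orP[/eqP//|] : (X s b == 0) || (Cv s ^+ 2 + Sv s ^+ 2 == 0) by rewrite -mulf_eq0 e3.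
rewrite paddr_eq0 ?sqr_ge0// !sqrf_eq0 => /andP[/eqP C0 /eqP S0].
have cond0 (k : r.-tuple R -> R) : bounded_mfun k ->
    \int[prior]_t (v t * k (block_ratios PP t)) = 0 ->
    cond_expectation (prob Mu) (obs Mu @^-1` [set x])
      (fun y => k (block_ratios PP (param Mu y))) = 0.
  move=> bk k0.
  have bvk : bounded_mfun (fun u => ratio_weight x u * k u).
    by apply: bounded_mfunM => //; exact: bounded_ratio_weight.
  rewrite (unconstrained_cond_expectation (ratio_comp bk)).
  under eq_Rintegral do rewrite mulrCA [k _ * _]mulrC.
  rewrite (indep_block_Rintegral (bounded_count_weight R PP x) bvk).
  by rewrite k0 mulr0 mul0r.
move: phi_neq0; rewrite /posterior_char_fun.
rewrite (cond0 (fun u => cos (s * lr u)))//; last exact: bounded_mfun_cos.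
rewrite (cond0 (fun u => sin (s * lr u)))//; last exact: bounded_mfun_sin.
by rewrite eqxx.
Qed.

(* The hypothesis on the characteristic function gives the identity on a dense
   set of frequencies s, and its left-hand side is continuous in s. *)
Lemma same_posterior_orth :
  dense [set s | posterior_char_fun Mu x (rho c PP j) s != 0] ->
  forall s b, X s b = 0.
Proof.
move=> dens s b.
have near_s m : exists s', [/\ ball s m.+1%:R^-1 s' & X s' b = 0].
  have [||s' [bs' phi0]] := dens (ball s (m.+1%:R^-1 : R)).
  - by exists s; apply: ballxx; rewrite invr_gt0 ltr0n.
  - exact: ball_open.
  by exists s'; split=> //; exact: X_eq0.
have [u uP] := choice near_s.
have cu : u m @[m --> \oo] --> s.
  apply/cvgrPdist_lt => e e0.
  have /cvgrPdist_lt /(_ e e0) [N _ hN] := @cvg_harmonic R.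
  exists N => // m Nm; have [bm _] := uP m.
  move: bm; rewrite -ball_normE /= => bm; apply: lt_trans bm _.
  by have := hN m Nm; rewrite /= sub0r normrN ger0_norm// invr_ge0.
have [_ [M ZM]] := bZ.
have cvgX : X (u m) b @[m --> \oo] --> X s b.
  apply: (@bounded_cvg_Rintegral _ _ _ _ _ _ M).
  - by move=> m; exact: (block_comp (bZcos (u m) b)).1.
  - exact: (block_comp (bZcos s b)).1.
  - move=> m t; rewrite normrM -[M]mulr1 ler_pM//.
    by rewrite ler_norml cos_geN1 cos_le1.
  - move=> t; rewrite normrM -[M]mulr1 ler_pM//.
    by rewrite ler_norml cos_geN1 cos_le1.
  move=> t; apply: cvgM; first exact: cvg_cst.
  apply: continuous_cvg; first exact: continuous_cos.
  by apply: cvgD; [apply: cvgM => //; exact: cvg_cst | exact: cvg_cst].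
apply/esym; apply: cvg_unique cvgX.
  exact: norm_hausdorff.
have Xu0 : (fun m => X (u m) b) = (fun=> 0).
  by apply/funext => m; have [] := uP m.
by rewrite /= Xu0; exact: cvg_cst.
Qed.

End OrthogonalLogSum.

End Posteriors.

Theorem theorem3p6 (R : realType) (n r d : nat)
  (n_gt0 : (0 < n)%N) (r_gt0 : (0 < r)%N) (d_gt0 : (0 < d)%N)
  (PP : {set {set 'I_r}}) (partPP : finset.partition PP [set: 'I_r]%SET)
  (c : 'M[R]_(r, d))
  (prior : probability (r.-tuple R) R)
  (prior_simplex : prior (simplex R r) = 1%E)
  (indep : independent_under prior (block_sums PP) (block_ratios PP))
  (* the unconstrained model, and the constrained model for each vector of
     fixed partition sums *)
  (Mu : bayes_model R r)
  (Mu_model : is_model prior (unconstrained_pmf n) Mu)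
  (Mc : ({set 'I_r} -> nat) -> bayes_model R r)
  (Mc_model : forall s, is_model prior (constrained_pmf PP s) (Mc s)) :
  let same x := same_posterior (psi c) Mu (Mc (block_count x)) x in
  let block_coef (B : {set 'I_r}) (j : 'I_d) := \sum_(i in B) c i j in
  ((forall B j, B \in PP -> block_coef B j = 0) ->
     forall x : r.-tuple nat, (\sum_(i < r) tnth x i)%N = n -> same x)
  /\
  (* With a single block the two models coincide, so the conclusion fails. *)
  ((1 < #|PP|)%N ->
   (exists B j, B \in PP /\ block_coef B j <> 0) ->
   (exists f : r.-tuple R -> R,
      is_simplex_density prior f /\ forall t, simplex R r t -> 0 < f t) ->
   (exists js : 'I_d,
      [/\ exists2 B, B \in PP & block_coef B js <> 0,
          forall x : r.-tuple nat, (\sum_(i < r) tnth x i)%N = n ->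
            dense [set t : R | posterior_char_fun Mu x (rho c PP js) t != 0] &
          let Kp := [set B in PP | 0 < block_coef B js]%SET in
          let Km := [set B in PP | block_coef B js < 0]%SET in
          ((0 < #|Kp|)%N /\ (#|Kp| <= n)%N) \/
          ((0 < #|Km|)%N /\ (#|Km| <= n)%N)]) ->
   exists x : r.-tuple nat, (\sum_(i < r) tnth x i)%N = n /\ ~ same x).
Proof.
move=> same block_coef; split=> [coef0 x xn|].
  exact: same_posterior_of_block_coef0 (Mc_model _) xn coef0.
move=> PP_gt1 _ [f [priorf f_gt0]] [js [_ dens Kpm]].
have finish (a : {set 'I_r} -> R) (sg : R) :
    (forall B, a B = sg * block_coef B js) ->
    (0 < #|[set B in PP | (0 < a B)%R]%SET|)%N ->
    (#|[set B in PP | (0 < a B)%R]%SET| <= n)%N ->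
    exists x : r.-tuple nat, (\sum_(i < r) tnth x i)%N = n /\ ~ same x.
  move=> aE K_gt0 Kn; set K := [set B in PP | _]%SET in K_gt0 Kn.
  have KPP : K \subset PP by apply/fintype.subsetP => B; rewrite inE => /andP[].
  have [x xn xK] := counts_positive_on_blocks partPP KPP K_gt0 Kn.
  exists x; split=> // same_x.
  apply: (count_weight_not_orth_trig partPP (x := x) prior_simplex PP_gt1 _ _
    priorf f_gt0 (a := a)).
  - by have /card_gt0P[B] := K_gt0; rewrite inE => /andP[PB aB]; exists B.
  - by move=> B PB aB; apply: xK; rewrite inE PB.
  move=> s b.
  rewrite -(same_posterior_orth partPP prior_simplex indep Mu_model (Mc_model _) xn
    same_x (dens x xn) (s * sg) b).
  apply: eq_Rintegral => t _; congr (_ * cos (_ + _)); rewrite /log_sum -mulrA.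
  congr (_ * _); rewrite mulr_sumr; apply: eq_bigr => k _.
  by rewrite aE mulrA.
case: Kpm => [[K_gt0 Kn]|[K_gt0 Kn]].
  by apply: (finish (fun B => block_coef B js) 1) => // B; rewrite mul1r.
have KmE : [set B in PP | (0 < - block_coef B js)%R]%SET =
    [set B in PP | (block_coef B js < 0)%R]%SET.
  by apply/setP => B; rewrite !inE oppr_gt0.
by apply: (finish (fun B => - block_coef B js) (-1)) => [B||]; rewrite ?KmE// mulN1r.
Qed.
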